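(* Let $N\ge 2$ be an integer, let $m_0,m_0'\in L^\infty(\mathbb{T})$ be non-singular, and let $h,h'\in L^1(\mathbb{T})$ satisfy $h,h'\ge 0$, $R_{m_0,m_0}h=h$ and $R_{m_0',m_0'}h'=h'$. Let $(\pi,U,\mathcal{H},\varphi)$ be the cyclic representation associated to $h$ (and $m_0$), and let $(\pi',U',\mathcal{H}',\varphi')$ be the cyclic representation associated to $h'$ (and $m_0'$). If $h_0\in L^1(\mathbb{T})$ satisfies $R_{m_0,m_0'}h_0=h_0$ and $|h_0|^2\le c\,h\,h'$ (a.e. on $\mathbb{T}$) for some constant $c>0$, then there exists a unique bounded linear operator $S:\mathcal{H}'\to\mathcal{H}$ such that $$SU'=US,\qquad S\pi'(f)=\pi(f)S\quad (f\in L^\infty(\mathbb{T})),$$ $$\langle \varphi,\pi(f)S\varphi'\rangle=\int_{\mathbb{T}}f h_0\,d\mu\quad (f\in L^\infty(\mathbb{T})).$$ Moreover $\|S\|\le\sqrt{c}$.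
   Context: $\mathbb{T}$ is the unit circle with normalized Haar measure $\mu$; $N\ge2$ is a fixed integer. A function $m\in L^\infty(\mathbb{T})$ is non-singular if it does not vanish on a subset of $\mathbb{T}$ of positive measure. Inner products are linear in the second variable and conjugate-linear in the first. For $m_0,m_0'\in L^\infty(\mathbb{T})$, the Ruelle transfer operator on $L^1(\mathbb{T})$ is $$R_{m_0,m_0'}f(z)=\frac1N\sum_{w^N=z}\overline{m_0(w)}\,m_0'(w)f(w).$$ Cyclic representation associated to $h$: given a non-singular $m_0\in L^\infty(\mathbb{T})$ and $h\in L^1(\mathbb{T})$, $h\ge0$, $R_{m_0,m_0}h=h$, it is a quadruple $(\pi,U,\mathcal{H},\varphi)$ where $\mathcal{H}$ is a Hilbert space, $\pi$ is a unital normal $*$-representation of $L^\infty(\mathbb{T})$ on $\mathcal{H}$, $U$ is a unitary on $\mathcal{H}$ with $U\pi(f)U^{-1}=\pi(f(z^N))$ for all $f\in L^\infty(\mathbb{T})$ (where $f(z^N)$ denotes $z\mapsto f(z^N)$), and $\varphi\in\mathcal{H}$ satisfies $U\varphi=\pi(m_0)\varphi$ and $\langle\varphi,\pi(f)\varphi\rangle=\int_{\mathbb{T}}fh\,d\mu$ for all $f\in L^\infty(\mathbb{T})$, and is cyclic, i.e. $\{U^{-n}\pi(f)\varphi : n\in\mathbb{N},\ f\in L^\infty(\mathbb{T})\}$ is dense in $\mathcal{H}$. Such a quadruple exists and is unique up to unitary equivalence (a known theorem of Jorgensen). For $m_0'$, $h'$ the definition is the same with $m_0',h'$ in place of $m_0,h$.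 *)

(* Defs.v *)
From HB Require Import structures.
From mathcomp Require Import all_boot all_order all_algebra complex.
From mathcomp Require Import all_classical all_reals all_analysis.
From mathcomp Require Import measurable_realfun.

Set Implicit Arguments.
Unset Strict Implicit.
Unset Printing Implicit Defensive.
Import Order.TTheory GRing.Theory Num.Theory.
Import numFieldNormedType.Exports.

Local Open Scope classical_set_scope.
Local Open Scope complex_scope.
Local Open Scope ring_scope.

Section Circle.
Variable R : realType.

Definition circle := {z : R[i] | `|z| == 1}.

HB.instance Definition _ := Choice.on circle.

Lemma circle1_subproof : `|1 : R[i]| == 1.
Proof. by rewrite normr1. Qed.

HB.instance Definition _ :=
  isPointed.Build circle (exist _ (1 : R[i]) circle1_subproof).

Lemma circleX_subproof (n : nat) (z : circle) : `|val z ^+ n| == 1.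
Proof. by rewrite normrX (eqP (valP z)) expr1n. Qed.

Definition circleX (n : nat) (z : circle) : circle :=
  exist _ (val z ^+ n) (circleX_subproof n z).

Definition circle_coord (z : circle) : R * R :=
  (complex.Re (val z), complex.Im (val z)).

(* The trace on the circle of the Borel sigma-algebra of R * R. *)
HB.instance Definition _ :=
  Measurable.copy circle (g_sigma_algebra_preimageType circle_coord).

Lemma expi_subproof (t : R) :
  `|cos (2 * pi * t) +i* sin (2 * pi * t)| == 1.
Proof. by rewrite normc_def /= cos2Dsin2 sqrtr1. Qed.

Definition expi (t : measurableTypeR R) : circle :=
  exist _ (cos (2 * pi * t) +i* sin (2 * pi * t)) (expi_subproof t).

Lemma measurable_expi : measurable_fun [set: measurableTypeR R] expi.
Proof.
have mlin : measurable_fun [set: measurableTypeR R]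
    (fun t : measurableTypeR R => 2 * pi * t : R).
  exact: mulrl_measurable.
have mc : measurable_fun [set: measurableTypeR R] (circle_coord \o expi).
  apply/measurable_fun_pairP; split.
  - apply: (measurableT_comp (f := @cos R) _ mlin).
    by apply: continuous_measurable_fun; apply: continuous_cos.
  - apply: (measurableT_comp (f := @sin R) _ mlin).
    by apply: continuous_measurable_fun; apply: continuous_sin.
move=> _ _ [B mB <-]; rewrite setTI -comp_preimage.
have := mc measurableT B mB; rewrite setTI; exact.
Qed.

HB.instance Definition _ :=
  isMeasurableFun.Build _ _ _ _ expi measurable_expi.

(* Normalized Haar measure: the law of e^(2 i pi t), t uniform on [0, 1]. *)
Definition haar : probability circle R :=
  distribution (uniform_prob (@ltr01 R)) expi.

End Circle.

Section FunctionSpaces.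
Variable R : realType.
Notation C := R[i].
Notation mu := (haar R).
Implicit Types f g m : circle R -> C.

(* Elements of L^1 and L^oo are represented by honest functions; equality and
   order of classes are expressed almost everywhere. *)

Definition cmeasurable f :=
  measurable_fun setT (fun z => complex.Re (f z)) /\
  measurable_fun setT (fun z => complex.Im (f z)).

Definition isL1 f :=
  mu.-integrable setT (fun z => (complex.Re (f z))%:E) /\
  mu.-integrable setT (fun z => (complex.Im (f z))%:E).

Definition isLoo f :=
  cmeasurable f /\ exists M : R, {ae mu, forall z, `|f z| <= M%:C}.

Definition cintegral f : C :=
  (\int[mu]_z complex.Re (f z)) +i* (\int[mu]_z complex.Im (f z)).

Definition nonsingular m := forall A : set (circle R), measurable A ->
  (forall z, A z -> m z = 0) -> ~ (0 < mu A)%E.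

Definition ruelle (N : nat) m m' f : circle R -> C := fun z =>
  N%:R^-1 * \sum_(w \in [set w : circle R | circleX N w = z])
              ((m w)^* * m' w * f w).

(* The order of R[i] is used here: a <= b means that b - a is a nonnegative
   real number. *)
Definition ae_le f g := {ae mu, forall z, f z <= g z}.

Definition isLoo_real f :=
  isLoo f /\ {ae mu, forall z, f z \is Num.real}.

(* f is the supremum in the self-adjoint part of L^oo of the upward directed
   set F. *)
Definition directed_sup (F : set (circle R -> C)) f :=
  [/\ F !=set0,
      (forall g, F g -> isLoo_real g),
      (forall g1 g2, F g1 -> F g2 ->
         exists g, [/\ F g, ae_le g1 g & ae_le g2 g]),
      isLoo_real f &
      (forall g, F g -> ae_le g f) /\
      (forall f', isLoo_real f' -> (forall g, F g -> ae_le g f') ->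
         ae_le f f')].

End FunctionSpaces.

HB.mixin Record CompleteNormedModule_isHilbert (R : realType) H
    of CompleteNormedModule R[i] H := {
  inner : H -> H -> R[i];
  innerDZr : forall (x : H) (a : R[i]) (y z : H),
    inner x (a *: y + z) = a * inner x y + inner x z;
  inner_conj : forall x y : H, inner y x = (inner x y)^*;
  inner_norm : forall x : H, inner x x = `|x| ^+ 2
}.

#[short(type="hilbertType")]
HB.structure Definition Hilbert (R : realType) :=
  {H of CompleteNormedModule R[i] H & CompleteNormedModule_isHilbert R H}.

Section Operators.
Variable R : realType.

Definition bounded_linear (H K : hilbertType R) (S : H -> K) :=
  linear S /\ exists M : R, forall x, `|S x| <= M%:C * `|x|.

Definition opnorm (H K : hilbertType R) (S : H -> K) : R :=
  sup [set complex.Re `|S x| | x in [set x : H | `|x| <= 1]].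

Record unitary (H : hilbertType R) := Unitary {
  unitary_fun :> H -> H;
  unitary_inv : H -> H;
  unitary_linear : linear unitary_fun;
  unitary_inner : forall x y, inner (unitary_fun x) (unitary_fun y) = inner x y;
  unitaryK : cancel unitary_fun unitary_inv;
  unitaryVK : cancel unitary_inv unitary_fun
}.

(* A representation of L^oo is a map on functions whose values outside isLoo are
   irrelevant and which identifies almost everywhere equal elements of isLoo.
   Normality (rep_normal) is preservation of suprema of upward directed sets,
   suprema of self-adjoint operators being those of the quadratic forms. *)
Record normal_representation (H : hilbertType R)
    (rho : (circle R -> R[i]) -> H -> H) : Prop := NormalRepresentation {
  rep_bounded : forall f, isLoo f -> bounded_linear (rho f);
  rep_ae : forall f g, isLoo f -> isLoo g ->
    {ae haar R, forall z, f z = g z} -> forall x, rho f x = rho g x;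
  rep_linear : forall (a : R[i]) f g, isLoo f -> isLoo g ->
    forall x, rho (fun z => a * f z + g z) x = a *: rho f x + rho g x;
  rep_mul : forall f g, isLoo f -> isLoo g ->
    forall x, rho (fun z => f z * g z) x = rho f (rho g x);
  rep_one : forall x, rho (fun=> 1) x = x;
  rep_star : forall f, isLoo f ->
    forall x y, inner (rho f x) y = inner x (rho (fun z => (f z)^*) y);
  rep_normal : forall F f, directed_sup F f ->
    forall x, supremums [set inner x (rho g x) | g in F] (inner x (rho f x))
}.

Record cyclic_representation (N : nat) (m0 h : circle R -> R[i])
    (H : hilbertType R) (rho : (circle R -> R[i]) -> H -> H)
    (U : unitary H) (phi : H) : Prop := CyclicRepresentation {
  cyc_rep : normal_representation rho;
  cyc_covariant : forall f, isLoo f ->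
    forall x, U (rho f (unitary_inv U x)) = rho (fun z => f (circleX N z)) x;
  cyc_refine : U phi = rho m0 phi;
  cyc_state : forall f, isLoo f ->
    inner phi (rho f phi) = cintegral (fun z => f z * h z);
  cyc_dense : dense [set x | exists n f,
    isLoo f /\ x = iter n (unitary_inv U) (rho f phi)]
}.

End Operators.

(* Main.v *)
Require Import Defs.
From HB Require Import structures.
From mathcomp Require Import all_boot all_order all_algebra complex.
From mathcomp Require Import all_classical all_reals all_analysis.
From mathcomp Require Import measurable_realfun ring lra.
Set Implicit Arguments.
Unset Strict Implicit.
Unset Printing Implicit Defensive.
Import Order.TTheory GRing.Theory Num.Theory.
Import numFieldNormedType.Exports.
Local Open Scope classical_set_scope.
Local Open Scope complex_scope.
Local Open Scope ring_scope.

(** Call a vector [U ^-n (rho f phi)] a generator of level [n]. Since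
    [U phi = rho m0 phi], a generator of level [n] given by [f] is one of level
    [n + 1], given by [f (z ^ N) m0 z]; so the generators form an increasing
    union of subspaces, which is dense by cyclicity. The same holds on the primed
    side.

    If [S] is an intertwiner with the prescribed moments, the inner product of
    the generator of level [n] given by [f] with the image by [S] of the primed
    generator of level [n] given by [g] has to be the integral of
    (conjugate of f) g h0, whatever [n] is. This gives uniqueness at once
    ([intertwiner_unique]), and existence if the formula defines a bounded
    sesquilinear form.

    - It is well defined because raising the level of both vectors does not
      change the integral ([pairing_lift]): the transfer operator is dual to the
      composition with [z ^ N], and [h0] is one of its fixed points
      ([cintegral_ruelle_fixed]).
    - It is bounded by [sqrt c] because the modulus of [h0] is at most
      [sqrt c] times the geometric mean of [h] and [h'], so that a Cauchy-Schwarz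
      inequality bounds the integral by [sqrt c] times the norms of [f] and [g]
      for the densities [h] and [h'] ([cintegral_cauchy_schwarz]); these are the
      norms of the two generators.

    A bounded sesquilinear form on dense subspaces is given by an operator with
    the same bound ([bounded_form_operator], deduced from the representation
    theorem [riesz]). The commutation relations hold because they hold for the
    form, by [exists_intertwiner], and the norm estimate is the bound of the
    form.

    The duality rests on the computation of Haar integrals in the coordinate [t]
    of [expi t]: the unit interval is cut into [N] pieces, each of which is
    the image of the whole interval under one inverse branch of [z ^ N]
    ([Rintegral_fibre]), and the [N] branches exhaust the fibre over [expi t]
    because a polynomial of degree [N] has no more than [N] roots
    ([fibre_circleX]). *)

(** * Complex numbers and moduli *)

Section ComplexModulus.
Variable R : realType.
Notation C := R[i].

Lemma complex_eqP (a b : C) :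
  complex.Re a = complex.Re b -> complex.Im a = complex.Im b -> a = b.
Proof. by case: a => ? ?; case: b => ? ? /= -> ->. Qed.

Lemma ReD (a b : C) : complex.Re (a + b) = complex.Re a + complex.Re b.
Proof. by case: a; case: b. Qed.

Lemma ImD (a b : C) : complex.Im (a + b) = complex.Im a + complex.Im b.
Proof. by case: a; case: b. Qed.

Lemma ReM (a b : C) : complex.Re (a * b) =
  complex.Re a * complex.Re b - complex.Im a * complex.Im b.
Proof. by case: a; case: b. Qed.

Lemma ImM (a b : C) : complex.Im (a * b) =
  complex.Re a * complex.Im b + complex.Im a * complex.Re b.
Proof. by case: a; case: b. Qed.

Lemma ReJ (a : C) : complex.Re (a^*) = complex.Re a.
Proof. by case: a. Qed.

Lemma ImJ (a : C) : complex.Im (a^*) = - complex.Im a.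
Proof. by case: a. Qed.

(** The norms of the statement are complex numbers; [nrm] is their value in
    the totally ordered field [R], where [lra] and [nra] apply. *)
Definition nrm (V : normedZmodType C) (x : V) : R := complex.Re `|x|.

Lemma nrmE (V : normedZmodType C) (x : V) : `|x| = (nrm x)%:C.
Proof.
have := normr_ge0 x; rewrite lecE /= => /andP[/eqP h _].
by apply: complex_eqP; rewrite /nrm //= h.
Qed.

Lemma nrm_ge0 (V : normedZmodType C) (x : V) : 0 <= nrm x.
Proof. by have := normr_ge0 x; rewrite nrmE ler0c. Qed.

Lemma le_nrm (V : normedZmodType C) (x : V) (r : R) :
  (`|x| <= r%:C) = (nrm x <= r).
Proof. by rewrite nrmE lecR. Qed.

Lemma nrmN (V : normedZmodType C) (x : V) : nrm (- x) = nrm x.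
Proof. by rewrite /nrm normrN. Qed.

Lemma nrm0_eq0 (V : normedZmodType C) (x : V) : nrm x = 0 -> x = 0.
Proof. by move=> h; apply/normr0_eq0; rewrite nrmE h. Qed.

Lemma ler_nrmD (V : normedZmodType C) (x y : V) : nrm (x + y) <= nrm x + nrm y.
Proof. by have := ler_normD x y; rewrite !nrmE -rmorphD lecR. Qed.

Lemma nrm_sqr (z : C) : nrm z ^+ 2 = complex.Re z ^+ 2 + complex.Im z ^+ 2.
Proof.
rewrite /nrm normc_def /= sqr_sqrtr //.
by apply: addr_ge0; apply: sqr_ge0.
Qed.

Lemma nrm_real (r : R) : nrm (r%:C : C) = `|r|.
Proof. by rewrite /nrm normc_def /= expr0n addr0 sqrtr_sqr. Qed.

Lemma nrmM (a b : C) : nrm (a * b) = nrm a * nrm b.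
Proof. by rewrite /nrm normrM !nrmE -rmorphM. Qed.

Lemma nrmJ (a : C) : nrm a^* = nrm a.
Proof. by rewrite /nrm norm_conjC. Qed.

Lemma Re_le_nrm (z : C) : complex.Re z <= nrm z.
Proof.
have := nrm_ge0 z; have := nrm_sqr z; nra.
Qed.

Lemma normRe_le_nrm (a : C) : `|complex.Re a| <= nrm a.
Proof.
rewrite -(ler_pXn2r (n := 2)) ?nnegrE ?nrm_ge0 // real_normK ?num_real // nrm_sqr.
by rewrite lerDl sqr_ge0.
Qed.

Lemma normIm_le_nrm (a : C) : `|complex.Im a| <= nrm a.
Proof.
rewrite -(ler_pXn2r (n := 2)) ?nnegrE ?nrm_ge0 // real_normK ?num_real // nrm_sqr.
by rewrite lerDr sqr_ge0.
Qed.

Lemma nrm_le_ReIm (a : C) : nrm a <= `|complex.Re a| + `|complex.Im a|.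
Proof.
rewrite -(ler_pXn2r (n := 2)) ?nnegrE ?nrm_ge0 ?addr_ge0 // nrm_sqr.
rewrite sqrrD !real_normK ?num_real // addrAC lerDl.
by rewrite mulrn_wge0 // mulr_ge0.
Qed.

(** The common source of the Cauchy-Schwarz inequalities for [inner] and for
    integrals. The polynomial is tested at its minimum [- b / a], or, when
    [a = 0], at a point where it would take the value [- 1]. *)
Lemma discriminant_le (a b e : R) : 0 <= a ->
  (forall t, 0 <= t ^+ 2 * a + t * b *+ 2 + e) -> b ^+ 2 <= a * e.
Proof.
rewrite le_eqVlt => /orP[/eqP <- h|a0 h].
  case: (eqVneq b 0) => [->|b0]; first by rewrite expr0n mul0r.
  have := h (- (e + 1) / (b *+ 2)).
  suff -> : - (e + 1) / (b *+ 2) * b *+ 2 = - (e + 1) by lra.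
  by field.
have := h (- b / a).
have -> : (- b / a) ^+ 2 * a + - b / a * b *+ 2 + e = (a * e - b ^+ 2) / a.
  by field; rewrite gt_eqF.
by rewrite pmulr_lge0 ?invr_gt0// subr_ge0.
Qed.

Lemma eq0_of_small (q k : R) : (forall e, 0 < e -> e <= 1 -> q ^+ 2 <= k * e) ->
  q = 0.
Proof.
move=> h; apply/eqP; rewrite -sqrf_eq0 eq_le sqr_ge0 andbT leNgt; apply/negP => q0.
have k0 : 0 <= k by have := h 1 ltr01 (lexx _); lra.
have p0 : 0 < q ^+ 2 + k + 1 by lra.
have := h (q ^+ 2 / (q ^+ 2 + k + 1)).
rewrite divr_gt0 // ler_pdivrMr // mul1r => /(_ isT).
have -> : (q ^+ 2 <= q ^+ 2 + k + 1) by lra.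
move=> /(_ isT); rewrite mulrA ler_pdivlMr //; nra.
Qed.

End ComplexModulus.

(** * Hilbert spaces and bounded sesquilinear forms *)

Section HilbertSpaces.
Variable R : realType.
Notation C := R[i].
Implicit Types H K : hilbertType R.

Lemma inner_nrm H (x : H) : inner x x = (nrm x ^+ 2)%:C.
Proof. by rewrite inner_norm nrmE rmorphXn. Qed.

Lemma inner0r H (x : H) : inner x 0 = 0.
Proof.
have := innerDZr x 1 0 0; rewrite scaler0 addr0 mul1r => /(congr1 (fun u => u - inner x 0)).
by rewrite subrr addrK.
Qed.

Lemma innerDr H (x y z : H) : inner x (y + z) = inner x y + inner x z.
Proof. by have := innerDZr x 1 y z; rewrite scale1r mul1r. Qed.

Lemma innerZr H (x : H) a (y : H) : inner x (a *: y) = a * inner x y.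
Proof. by have := innerDZr x a y 0; rewrite inner0r !addr0. Qed.

Lemma innerBr H (x y z : H) : inner x (y - z) = inner x y - inner x z.
Proof. by rewrite innerDr -scaleN1r innerZr mulN1r. Qed.

Lemma innerDl H (x y z : H) : inner (x + y) z = inner x z + inner y z.
Proof. by rewrite inner_conj innerDr rmorphD /= -!inner_conj. Qed.

Lemma innerBl H (x y z : H) : inner (x - y) z = inner x z - inner y z.
Proof. by rewrite inner_conj innerBr rmorphB /= -!inner_conj. Qed.

Lemma inner_swap H K (x y : H) (x' y' : K) :
  inner x y = inner x' y' -> inner y x = inner y' x'.
Proof. by move=> e; rewrite inner_conj e -inner_conj. Qed.

Lemma nrmD_sqr H (x y : H) :
  nrm (x + y) ^+ 2 = nrm x ^+ 2 + nrm y ^+ 2 + complex.Re (inner x y) *+ 2.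
Proof.
have /(congr1 (@complex.Re R)) := inner_nrm (x + y).
rewrite /= => <-; rewrite innerDl !innerDr !inner_nrm !ReD /=.
rewrite [inner y x]inner_conj ReJ; ring.
Qed.

Lemma nrmZ H a (x : H) : nrm (a *: x) = nrm a * nrm x.
Proof. by rewrite /nrm normrZ !nrmE -rmorphM. Qed.

Lemma Re_inner_sqr_le H (x y : H) :
  complex.Re (inner x y) ^+ 2 <= nrm x ^+ 2 * nrm y ^+ 2.
Proof.
rewrite mulrC; apply: discriminant_le => [|t]; first exact: sqr_ge0.
have := sqr_ge0 (nrm (x + (t%:C) *: y)).
rewrite nrmD_sqr nrmZ nrm_real innerZr ReM /= mul0r subr0 exprMn real_normK ?num_real //.
lra.
Qed.

(** The real inequality, applied to [y] rotated by the conjugate of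
    [inner x y], bounds the modulus and not only the real part. *)
Lemma nrm_inner H (x y : H) : nrm (inner x y) <= nrm x * nrm y.
Proof.
set a := inner x y.
have [->|a0] := eqVneq (nrm a) 0; first by rewrite mulr_ge0 ?nrm_ge0.
have agt : 0 < nrm a by rewrite lt_neqAle eq_sym a0 nrm_ge0.
have := Re_inner_sqr_le x (a^* *: y).
rewrite innerZr -/a nrmZ nrmJ.
rewrite ReM ReJ ImJ.
have -> : complex.Re a * complex.Re a - - complex.Im a * complex.Im a = nrm a ^+ 2.
  by rewrite nrm_sqr; ring.
rewrite -exprMn ler_pXn2r ?nnegrE ?sqr_ge0 //; last first.
  by rewrite !mulr_ge0 ?nrm_ge0.
have := nrm_ge0 x; have := nrm_ge0 y => ? ?; nra.
Qed.

Lemma dense_approx (H : hilbertType R) (D : set H) (x : H) (e : R) :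
  dense D -> 0 < e -> exists2 y, D y & nrm (x - y) < e.
Proof.
move=> dD e0.
have ec : 0 < (e%:C : C) by rewrite ltcR.
have [|y [xy Dy]] := dD (ball x (e%:C : C)) _ (ball_open x _).
  by exists x; apply: ballxx.
exists y => //; move: xy; rewrite -ball_normE /ball_ /=.
by rewrite nrmE ltcR.
Qed.

(** The difference of the two vectors is orthogonal to a dense set, hence to
    vectors arbitrarily close to itself. *)
Lemma dense_inner_eq H (D : set H) (v w : H) : dense D ->
  (forall x, D x -> inner x v = inner x w) -> v = w.
Proof.
move=> dD h; apply/eqP; rewrite -subr_eq0; apply/eqP.
set u := v - w.
have hu x : D x -> inner x u = 0 by move=> /h; rewrite innerBr => ->; rewrite subrr.
apply: nrm0_eq0; apply/eqP; rewrite eq_le nrm_ge0 andbT leNgt; apply/negP => u0.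
have [x Dx ux] := dense_approx u dD u0.
have := nrm_inner (u - x) u; rewrite innerBl (hu _ Dx) subr0 inner_nrm nrm_real.
rewrite ger0_norm ?sqr_ge0 //; nra.
Qed.

Definition subspace H (D : set H) :=
  D !=set0 /\ forall (a : C) x y, D x -> D y -> D (a *: x + y).

Definition linear_on H (D : set H) (l : H -> C) :=
  forall (a : C) x y, D x -> D y -> l (a *: x + y) = a * l x + l y.

Lemma subspaceD H (D : set H) x y : subspace D -> D x -> D y -> D (x + y).
Proof. by move=> [_ h] Dx Dy; rewrite -[x]scale1r; apply: h. Qed.

Lemma subspace0 H (D : set H) : subspace D -> D 0.
Proof.
by move=> [[x Dx] h]; have := h (-1) _ _ Dx Dx; rewrite scaleN1r addNr.
Qed.

Lemma subspaceZ H (D : set H) a x : subspace D -> D x -> D (a *: x).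
Proof.
by move=> sD Dx; rewrite -[_ *: _]addr0; apply: sD.2 => //; exact: subspace0.
Qed.

Lemma linear_onZ H (D : set H) l a x : subspace D -> linear_on D l -> D x ->
  l (a *: x) = a * l x.
Proof.
move=> sD ll Dx; have D0 := subspace0 sD.
have l0 : l 0 = 0.
  have := ll 1 _ _ D0 D0; rewrite scaler0 addr0 mul1r => /(congr1 (fun u => u - l 0)).
  by rewrite subrr addrK.
by have := ll a _ _ Dx D0; rewrite addr0 l0 addr0.
Qed.

Lemma linear_onD H (D : set H) l x y : linear_on D l -> D x -> D y ->
  l (x + y) = l x + l y.
Proof. by move=> ll Dx Dy; have := ll 1 _ _ Dx Dy; rewrite scale1r mul1r. Qed.

(** Representation of a bounded functional that is only defined on a subspace,
    which need not be closed. The functional [J x], the square of [nrm x] minus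
    twice the real part of [l x], is bounded below on [D]; by the parallelogram
    law its near-minimizers form a Cauchy filter, and the first-order condition
    at the limit [s] reads [inner s x = l x]. *)
Lemma riesz H (D : set H) (l : H -> C) (M : R) : 0 <= M -> subspace D ->
  linear_on D l -> (forall x, D x -> nrm (l x) <= M * nrm x) ->
  exists2 s, (forall x, D x -> inner s x = l x) & nrm s <= M.
Proof.
move=> M0 sD ll lM.
pose J x := nrm x ^+ 2 - complex.Re (l x) *+ 2.
have Jlb x : D x -> - M ^+ 2 <= J x.
  move=> Dx; rewrite /J; have := lM _ Dx; have := Re_le_nrm (l x).
  by have := sqr_ge0 (nrm x - M); nra.
pose d := inf (J @` D).
have hinf : has_inf (J @` D).
  split; first by exists (J 0), 0 => //; exact: subspace0.
  by exists (- M ^+ 2) => _ [x Dx <-]; exact: Jlb.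
have Jd x : D x -> d <= J x.
  by move=> Dx; apply: ge_inf; [exact: hinf.2 | exists x].
pose A e : set H := [set x | D x /\ J x < d + e].
have A0 e : 0 < e -> exists x, A e x.
  by move=> e0; have [_ [x Dx <-] xe] := inf_adherent e0 hinf; exists x.
pose F : set_system H := filter_from [set e : R | 0 < e] A.
have FF : ProperFilter F.
  apply: filter_from_proper; last by move=> e /A0.
  apply: filter_from_filter; first by exists 1 => /=.
  move=> e1 e2 /= e10 e20; exists (Num.min e1 e2); first by rewrite /= lt_min e10.
  move=> x [Dx]; rewrite /A /= -ltrBlDl lt_min => /andP[? ?].
  by split; split => //; rewrite -ltrBlDl.
(* parallelogram law: the midpoint of x and y has J at least d *)
have Adiam e x y : A e x -> A e y -> nrm (x - y) ^+ 2 <= e *+ 4.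
  move=> [Dx Jx] [Dy Jy].
  have Dxy := subspaceD sD Dx Dy.
  have := Jd _ (subspaceZ (2^-1%:C) sD Dxy).
  rewrite {1}/J nrmZ (linear_onZ _ sD ll Dxy) (linear_onD ll Dx Dy) ReM ReD /=.
  rewrite nrm_real ger0_norm ?invr_ge0 // exprMn.
  have := nrmD_sqr x y; have := nrmD_sqr x (- y).
  rewrite nrmN -scaleN1r innerZr mulN1r raddfN /= => -> ->.
  move: Jx Jy; rewrite /J.
  have -> : 2^-1 ^+ 2 = 4^-1 :> R by field.
  lra.
have cF : cauchy F.
  apply: cauchy_exP => eps eps0.
  have [e e0 ->] : exists2 e : R, 0 < e & eps = e%:C.
    move: eps0; rewrite ltcE => /andP[/eqP i0 r0].
    by exists (complex.Re eps) => //; apply: complex_eqP.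
  have e80 : 0 < e ^+ 2 / 8 by rewrite divr_gt0 ?exprn_gt0.
  have [x Ax] := A0 _ e80.
  exists x, (e ^+ 2 / 8) => // y /(Adiam _ _ _ Ax) xy.
  rewrite -ball_normE /ball_ /= nrmE ltcR -(ltr_pXn2r (n := 2)) ?nnegrE ?nrm_ge0 ?ltW //.
  have : 0 < e ^+ 2 by rewrite exprn_gt0.
  lra.
have /cauchy_cvg/cvg_ex[s Fs] := cF.
have near_s e : 0 < e -> exists2 x, A e x & nrm (s - x) < e.
  move=> e0.
  have Fb : F (ball s (e%:C : C)) by apply: Fs; apply: nbhsx_ballx; rewrite ltcR.
  have FA : F (A e) by exists e.
  have [x [xb xA]] := filter_ex (filterI Fb FA).
  by exists x => //; move: xb; rewrite -ball_normE /ball_ /= nrmE ltcR.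
(* first-order condition, in the direction y, at a near-minimizer close to s *)
have ReE y : D y -> complex.Re (inner s y) = complex.Re (l y).
  move=> Dy; apply/eqP; rewrite -subr_eq0; apply/eqP.
  apply: (@eq0_of_small _ _ (4 * nrm y ^+ 2)) => e e0 e1.
  have [x [Dx Jx] xe] := near_s _ e0.
  have h1 : (complex.Re (inner x y) - complex.Re (l y)) ^+ 2 <= nrm y ^+ 2 * e.
    apply: discriminant_le => [|t]; first exact: sqr_ge0.
    have := Jd _ (subspaceD sD Dx (subspaceZ t%:C sD Dy)).
    rewrite /J nrmD_sqr nrmZ nrm_real innerZr ReM /= mul0r subr0 exprMn.
    rewrite real_normK ?num_real // (linear_onD ll Dx) ?(linear_onZ _ sD ll Dy); last first.
      exact: subspaceZ.
    rewrite ReD ReM /= mul0r subr0; move: Jx; rewrite /J; lra.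
  have h2 := Re_inner_sqr_le (s - x) y.
  rewrite innerBl raddfB /= in h2.
  have h3 : nrm (s - x) ^+ 2 <= e.
    by have := nrm_ge0 (s - x); nra.
  have h4 : nrm (s - x) ^+ 2 * nrm y ^+ 2 <= nrm y ^+ 2 * e.
    by have := sqr_ge0 (nrm y); nra.
  set a := complex.Re (inner s y) in h2 *; set b := complex.Re (inner x y) in h1 h2.
  set m := complex.Re (l y) in h1 *.
  have := sqr_ge0 (a - b - (b - m)).
  lra.
have sl x : D x -> inner s x = l x.
  move=> Dx; apply: complex_eqP; first exact: ReE.
  (* the direction i x turns real parts into imaginary parts *)
  have := ReE _ (subspaceZ 'i%C sD Dx).
  by rewrite innerZr (linear_onZ _ sD ll Dx) !ReM /= !mul0r !mul1r !sub0r => /oppr_inj.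
exists s => //.
rewrite leNgt; apply/negP => Ms.
(* for x in D within e of s, nrm s ^+ 2 is at most M * nrm s + e * (M + nrm s);
   this contradicts the choice of e *)
have g0 : 0 < (nrm s * (nrm s - M)) / (M + nrm s + 1).
  by rewrite divr_gt0 ?mulr_gt0 //; lra.
set e := _ / _ in g0.
have [x [Dx _] xe] := near_s _ g0.
have := nrm_inner s (s - x).
rewrite innerBr (sl _ Dx) inner_nrm => h1.
have h2 := lM _ Dx.
have h3 := ler_nrmD (((nrm s ^+ 2)%:C : C) - l x) (l x).
rewrite subrK nrm_real ger0_norm ?sqr_ge0 // in h3.
have h4 := ler_nrmD s (x - s).
rewrite [in leLHS]addrC subrK -opprB nrmN in h4.
have h5 : e * (M + nrm s + 1) = nrm s * (nrm s - M).
  by rewrite /e divfK // gt_eqF //; lra.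
have := nrm_ge0 (s - x); nra.
Qed.

(** [riesz] is used on both sides. For [x] in [D] it represents [B x] by a
    vector [t x] of [K]. For any [y] in [K], not only in [E], it then represents
    [fun x => inner y (t x)] by a vector [S y] of [H]; so [S] is everywhere
    defined at once, without extension by continuity. *)
Lemma bounded_form_operator H K (D : set H) (E : set K) (B : H -> K -> C) (M : R) :
  0 <= M -> subspace D -> subspace E -> dense D -> dense E ->
  (forall y, E y -> linear_on D (fun x => (B x y)^*)) ->
  (forall x, D x -> linear_on E (B x)) ->
  (forall x y, D x -> E y -> nrm (B x y) <= M * nrm x * nrm y) ->
  exists S : K -> H, [/\ linear S, forall y, nrm (S y) <= M * nrm y &
    forall x y, D x -> E y -> inner x (S y) = B x y].
Proof.
move=> M0 sD sE dD dE linl linr BM.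
have /choice[t ht] x : exists v : K, D x ->
    (forall y, E y -> inner v y = B x y) /\ nrm v <= M * nrm x.
  have [Dx|nDx] := pselect (D x); last by exists 0.
  have [|v v1 v2] := riesz _ sE (linr _ Dx) (fun y => BM x y Dx).
    by rewrite mulr_ge0 // nrm_ge0.
  by exists v.
have lt y : linear_on D (fun x => inner y (t x)).
  move=> a x z Dx Dz.
  have -> : t (a *: x + z) = a *: t x + t z.
    apply: (dense_inner_eq dE) => w Ew.
    have Dxz := sD.2 a _ _ Dx Dz.
    rewrite [LHS]inner_conj (ht _ Dxz).1 // (linl _ Ew a x z Dx Dz).
    by rewrite innerDZr -(ht _ Dx).1 // -(ht _ Dz).1 // -!inner_conj.
  exact: innerDZr.
have /choice[S hS] y : exists v : H,
    (forall x, D x -> inner v x = inner y (t x)) /\ nrm v <= M * nrm y.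
  have [|x Dx|v v1 v2] := @riesz _ _ _ (M * nrm y) _ sD (lt y); last by exists v.
    by rewrite mulr_ge0 // nrm_ge0.
  apply: (le_trans (nrm_inner _ _)).
  by rewrite mulrAC mulrC ler_wpM2r ?nrm_ge0 // (ht _ Dx).2.
have SE x y : D x -> inner x (S y) = inner (t x) y.
  by move=> Dx; apply: inner_swap; apply: (hS y).1.
exists S; split.
- move=> a y z; apply: (dense_inner_eq dD) => x Dx.
  by rewrite innerDZr !SE // innerDZr.
- by move=> y; exact: (hS y).2.
- by move=> x y Dx Ey; rewrite SE // (ht _ Dx).1.
Qed.

Lemma unitary_inv_inner H (U : unitary H) x y :
  inner (unitary_inv U x) (unitary_inv U y) = inner x y.
Proof. by rewrite -(unitary_inner U) !unitaryVK. Qed.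

Lemma unitary_adjoint H (U : unitary H) x y :
  inner x (U y) = inner (unitary_inv U x) y.
Proof. by rewrite -[in RHS](unitary_inner U) unitaryVK. Qed.

Lemma unitary_inv_linear H (U : unitary H) : linear (unitary_inv U).
Proof.
move=> a x y; apply: (can_inj (@unitaryK _ _ U)).
by rewrite unitaryVK unitary_linear !unitaryVK.
Qed.

Lemma iter_unitary_inv_inner H (U : unitary H) n x y :
  inner (iter n (unitary_inv U) x) (iter n (unitary_inv U) y) = inner x y.
Proof. by elim: n => //= n IH; rewrite unitary_inv_inner. Qed.

Lemma bounded_linearP H K (S : K -> H) :
  bounded_linear S <-> linear S /\ exists M : R, forall x, nrm (S x) <= M * nrm x.
Proof.
have E (M : R) (x : K) : (`|S x| <= M%:C * `|x|) = (nrm (S x) <= M * nrm x).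
  by rewrite [`|x|]nrmE -rmorphM le_nrm.
by split=> -[lS [M hM]]; split=> //; exists M => x; [rewrite -E|rewrite E].
Qed.

Lemma bounded_linear_comp (K1 K2 K3 : hilbertType R) (S : K2 -> K3) (T : K1 -> K2) :
  bounded_linear S -> bounded_linear T -> bounded_linear (fun x => S (T x)).
Proof.
move=> /bounded_linearP[lS [M SM]] /bounded_linearP[lT [M' TM]].
apply/bounded_linearP; split; first by move=> a x y; rewrite lT lS.
exists (`|M| * M') => x; apply: (le_trans (SM _)).
apply: (@le_trans _ _ (`|M| * nrm (T x))).
  by rewrite ler_wpM2r ?nrm_ge0 // ler_norm.
by rewrite -mulrA ler_wpM2l.
Qed.

Lemma nrm_unitary (K : hilbertType R) (W : unitary K) x : nrm (W x) = nrm x.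
Proof.
apply/eqP; rewrite -(eqrXn2 (n := 2)) ?nrm_ge0 //.
by have /(congr1 (@complex.Re R)) /= := unitary_inner W x x; rewrite !inner_nrm => /= ->.
Qed.

Lemma bounded_linear_unitary (K : hilbertType R) (W : unitary K) : bounded_linear W.
Proof.
apply/bounded_linearP; split; first exact: unitary_linear.
by exists 1 => x; rewrite mul1r nrm_unitary.
Qed.

Lemma bounded_linear_dense_eq H K (S T : K -> H)
    (E : set K) : bounded_linear S -> bounded_linear T -> dense E ->
  (forall y, E y -> S y = T y) -> forall y, S y = T y.
Proof.
move=> /bounded_linearP[lS [M SM]] /bounded_linearP[lT [M' TM]] dE ST y.
have SB u v : S (u - v) = S u - S v.
  by rewrite addrC -scaleN1r lS scaleN1r addrC.
have TB u v : T (u - v) = T u - T v.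
  by rewrite addrC -scaleN1r lT scaleN1r addrC.
apply/eqP; rewrite -subr_eq0; apply/eqP/nrm0_eq0/eqP.
rewrite eq_le nrm_ge0 andbT leNgt; apply/negP => d0.
set d := nrm _ in d0.
have p0 : 0 < `|M| + `|M'| + 1.
  by have := normr_ge0 M; have := normr_ge0 M'; lra.
have [v Ev vy] := dense_approx y dE (divr_gt0 d0 p0).
have : d <= (`|M| + `|M'|) * nrm (y - v).
  rewrite /d (_ : S y - T y = S (y - v) + - T (y - v)); last first.
    by rewrite SB TB (ST _ Ev) opprB addrA subrK.
  apply: (le_trans (ler_nrmD _ _)); rewrite nrmN mulrDl lerD //.
    by apply: (le_trans (SM _)); rewrite ler_wpM2r ?nrm_ge0 // ler_norm.
  by apply: (le_trans (TM _)); rewrite ler_wpM2r ?nrm_ge0 // ler_norm.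
move: vy; rewrite ltr_pdivlMr // => vy; have := nrm_ge0 (y - v); lra.
Qed.

Lemma opnorm_le H K (S : K -> H) (M : R) :
  0 <= M -> (forall x, nrm (S x) <= M * nrm x) -> opnorm S <= M.
Proof.
move=> M0 SM; apply: ge_sup.
  by exists (complex.Re `|S 0|), 0 => //=; rewrite normr0.
move=> _ [x /= x1 <-]; apply: (le_trans (SM x)).
rewrite -[leRHS]mulr1 ler_wpM2l //.
by move: x1; rewrite -[1]/(1%:C) le_nrm.
Qed.

End HilbertSpaces.

(** * Inverse branches of the power map of the circle *)

Section CircleMeasure.
Variable R : realType.
Notation C := R[i].

Lemma cmeasurableM (f g : circle R -> C) :
  cmeasurable f -> cmeasurable g -> cmeasurable (fun z => f z * g z).
Proof.
move=> [f1 f2] [g1 g2]; split.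
- under eq_fun do rewrite ReM.
  by apply: measurable_funB; apply: measurable_funM.
- under eq_fun do rewrite ImM.
  by apply: measurable_funD; apply: measurable_funM.
Qed.

Lemma measurable_circle_coord : measurable_fun [set: circle R] (@circle_coord R).
Proof. by move=> _ B mB; exists B. Qed.

Lemma cmeasurable_val : cmeasurable (fun z : circle R => val z).
Proof.
split.
- exact: (measurableT_comp measurable_fst measurable_circle_coord).
- exact: (measurableT_comp measurable_snd measurable_circle_coord).
Qed.

Lemma measurable_circleX n : measurable_fun [set: circle R] (@circleX R n).
Proof.
have mX : cmeasurable (fun z : circle R => val z ^+ n).
  elim: n => [|n IH]; first by split; exact: measurable_cst.
  under [fun z : circle R => _]eq_fun do rewrite exprS.
  by apply: cmeasurableM => //; exact: cmeasurable_val.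
have mc : measurable_fun setT (@circle_coord R \o @circleX R n).
  by apply/measurable_fun_pairP; exact: mX.
move=> _ _ [B mB <-]; rewrite setTI -comp_preimage.
by have := mc measurableT B mB; rewrite setTI; exact.
Qed.

Lemma val_expi (t : R) :
  val (expi t : circle R) = cos (2 * pi * t) +i* sin (2 * pi * t).
Proof. by []. Qed.

Lemma expiM (s t : R) : val (expi (s + t) : circle R) = val (expi s) * val (expi t).
Proof.
rewrite !val_expi mulrDr cosD sinD; apply: complex_eqP; first by rewrite ReM.
by rewrite ImM /= addrC.
Qed.

Lemma expi_nat (n : nat) : val (expi (n%:R : R) : circle R) = 1.
Proof.
rewrite val_expi.
have -> : 2 * pi * n%:R = 0 + (pi *+ 2) *+ n :> R.
  by rewrite add0r -mulr_natr -[pi *+ 2]mulr_natr; ring.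
rewrite (periodicn (@cosD2pi R)) (periodicn (@sinD2pi R)) cos0 sin0.
exact: complex_eqP.
Qed.

Lemma expi_eq1 (t : R) : 0 <= t < 1 -> val (expi t : circle R) = 1 -> t = 0.
Proof.
move=> /andP[]; rewrite le_eqVlt => /orP[/eqP <- //|t0 t1].
rewrite val_expi => /(congr1 (@complex.Re R)) /=.
have -> : 2 * pi * t = pi * t + pi * t by ring.
rewrite cosD -!expr2 cos2sin2 => h.
have : 0 < sin (pi * t).
  apply: sin_gt0_pi; rewrite mulr_gt0 ?pi_gt0 //=.
  by rewrite -[ltRHS]mulr1 ltr_pM2l ?pi_gt0.
nra.
Qed.

Lemma expi_inj (s t : R) : `|s - t| < 1 ->
  (expi s : circle R) = expi t -> s = t.
Proof.
wlog st : s t / s <= t.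
  move=> W h1 h2; have [/W|/ltW/W W'] := leP s t; first exact.
  by apply/esym/W' => //; rewrite distrC.
rewrite ler0_norm ?subr_le0 // opprB => h1 h2; apply/esym/eqP.
rewrite -subr_eq0; apply/eqP/expi_eq1; first by rewrite subr_ge0 st.
have e0 : val (expi t : circle R) != 0.
  by rewrite -normr_eq0 (eqP (valP (expi t))) oner_eq0.
apply: (mulfI e0); rewrite mulr1.
by have := expiM s (t - s); rewrite addrC subrK h2.
Qed.

Lemma expiX n (t : R) : circleX n (expi t) = expi (n%:R * t) :> circle R.
Proof.
apply/val_inj; rewrite /=; elim: n => [|n IH].
  by rewrite mul0r mulr0 cos0 sin0; apply: complex_eqP.
rewrite exprS IH -!val_expi -expiM; congr (val (expi _)).
by rewrite -natr1; ring.
Qed.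

(** The [N] inverse branches of [z |-> z ^+ N], in the coordinate [t] of
    [expi t]. *)
Definition branch (N j : nat) (t : R) : R := (t + j%:R) / N%:R.

Lemma circleX_branch N j (t : R) : (0 < N)%N ->
  circleX N (expi (branch N j t)) = expi t :> circle R.
Proof.
move=> N0; rewrite expiX /branch mulrC divfK ?pnatr_eq0 -?lt0n //.
by apply/val_inj; rewrite expiM expi_nat mulr1.
Qed.

(** Two branches at the same [t] differ by an angle smaller than a full turn. *)
Lemma expi_branch_inj N (t : R) :
  injective (fun j : 'I_N => expi (branch N j t) : circle R).
Proof.
move=> i j /expi_inj ij.
have N0R : 0 < N%:R :> R by rewrite ltr0n (leq_ltn_trans _ (ltn_ord i)).
have : branch N i t = branch N j t.
  apply: ij; rewrite /branch -mulrBl opprD addrACA subrr add0r.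
  rewrite normrM normfV [`|N%:R|]ger0_norm ?ltW // ltr_pdivrMr // mul1r.
  have := ltn_ord i; have := ltn_ord j; rewrite -!(ltr_nat R) => jN iN.
  have := ler0n R i; have := ler0n R j; rewrite ltr_norml; lra.
have Ni : N%:R^-1 != 0 :> R by rewrite invr_eq0 gt_eqF.
by move=> /(mulIf Ni)/addrI/eqP; rewrite eqr_nat => /eqP/val_inj.
Qed.

(** The branches give [N] distinct roots of the polynomial ['X^N - expi t], so
    there is no other root. This avoids the surjectivity of [expi]. *)
Lemma fibre_circleX N (t : R) (w : circle R) : (0 < N)%N -> circleX N w = expi t ->
  exists j : 'I_N, w = expi (branch N j t).
Proof.
move=> N0 wN.
pose s := [seq val (expi (branch N j t) : circle R) | j : 'I_N].
have us : uniq s.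
  by rewrite map_inj_uniq ?enum_uniq // => i j /val_inj/expi_branch_inj.
pose p : {poly C} := 'X^N - (val (expi t : circle R))%:P.
have sp : size p = N.+1 by rewrite /p size_XnsubC.
have rs : all (root p) s.
  apply/allP => _ /mapP[j _ ->]; rewrite /root /p hornerD hornerN hornerXn hornerC subr_eq0.
  by have /(congr1 val) /= := @circleX_branch N j t N0 => ->.
have rw : root p (val w).
  rewrite /root /p hornerD hornerN hornerXn hornerC subr_eq0.
  by have /(congr1 val) /= := wN => ->.
have : val w \in s.
  apply/negPn/negP => ws.
  have p0 : p != 0 by rewrite -size_poly_eq0 sp.
  have := max_poly_roots p0 (rs := val w :: s); rewrite /= rw rs ws us => /(_ isT isT).
  by rewrite size_map size_enum_ord sp ltnn.
by move=> /mapP[j _ /val_inj wj]; exists j.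
Qed.

Lemma ruelle_expi N (m m' f : circle R -> C) (t : R) : (0 < N)%N ->
  ruelle N m m' f (expi t) = N%:R^-1 *
    \sum_(j < N) (let w := expi (branch N j t) in (m w)^* * m' w * f w).
Proof.
move=> N0; rewrite /ruelle; congr (_ * _).
rewrite (fsbigE [seq (expi (branch N j t) : circle R) | j : 'I_N]).
- rewrite big_map big_mkcond big_enum /=; apply: eq_bigr => j _.
  by rewrite mem_set //=; exact: circleX_branch.
- by rewrite map_inj_uniq ?enum_uniq //; exact: expi_branch_inj.
- by move=> _ /= /mapP[j _ ->]; exact: circleX_branch.
- move=> w /= /(fibre_circleX N0)[j ->].
  by move=> /negP[]; apply: (map_f (fun j : 'I_N => expi (branch N j t))); rewrite mem_enum.
Qed.

End CircleMeasure.

(** * Haar integrals and averages over fibres *)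

Section CircleIntegral.
Variable R : realType.
Notation mu := (haar R).
Notation leb := (@lebesgue_measure R).
Local Open Scope ereal_scope.

Lemma measurable_branch N j : measurable_fun setT
  (branch N j : measurableTypeR R -> measurableTypeR R).
Proof.
apply: measurable_funM => //; apply: measurable_funD => //.
Qed.

(** By uniqueness of Lebesgue measure it is enough to compare lengths of
    intervals. *)
Lemma lebesgue_measure_branch N j (A : set (measurableTypeR R)) : (0 < N)%N ->
  measurable A ->
  leb A = (N%:R^-1)%:E *
    leb ((branch N j : measurableTypeR R -> measurableTypeR R) @^-1` A).
Proof.
move=> N0 mA.
have N0R : (0 < N%:R :> R)%R by rewrite ltr0n.
have k0 : (0 <= N%:R^-1 :> R)%R by rewrite invr_ge0 ler0n.
have mb := measurable_branch N j.
pose f : {mfun measurableTypeR R >-> measurableTypeR R} :=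
  HB.pack (branch N j : measurableTypeR R -> measurableTypeR R)
    (isMeasurableFun.Build _ _ _ _ _ mb).
rewrite (@lebesgue_measure_unique R (mscale (NngNum k0) (pushforward leb f))) //.
move=> _ [[a b]] _ <- /=.
rewrite /mscale /= /pushforward.
have -> : (branch N j @^-1` `]a, b])%classic =
    (`](N%:R * a - j%:R)%R, (N%:R * b - j%:R)%R])%classic.
  apply/seteqP; split => t /=; rewrite !in_itv /= /branch ltr_pdivlMr // ler_pdivrMr //;
  rewrite ltrBlDr lerBrDr ![(N%:R * _)%R]mulrC //.
rewrite !lebesgue_measure_itv /= !lte_fin ltrD2r ltr_pM2l //.
case: ifPn => _; last by rewrite mule0.
by rewrite -!EFinB -EFinM; congr EFin; field; rewrite gt_eqF.
Qed.

Lemma ge0_integral_branch N j (f : R -> \bar R) : (0 < N)%N ->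
  measurable_fun [set: measurableTypeR R] f -> (forall t, 0 <= f t) ->
  \int[leb]_(t in `](j%:R / N%:R)%R, (j.+1%:R / N%:R)%R]) f t =
  (N%:R^-1)%:E * \int[leb]_(t in `]0%R, 1%R]) f (branch N j t).
Proof.
move=> N0 mf f0.
have N0R : (0 < N%:R :> R)%R by rewrite ltr0n.
have k0 : (0 <= N%:R^-1 :> R)%R by rewrite invr_ge0 ler0n.
have mb := measurable_branch N j.
pose b : {mfun measurableTypeR R >-> measurableTypeR R} :=
  HB.pack (branch N j : measurableTypeR R -> measurableTypeR R)
    (isMeasurableFun.Build _ _ _ _ _ mb).
rewrite (eq_measure_integral (mscale (NngNum k0) (pushforward leb b))); last first.
  by move=> A mA _; apply: lebesgue_measure_branch.
rewrite ge0_integral_mscale //=; last exact: measurable_funTS.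
rewrite ge0_integral_pushforward //=; last exact: measurable_funTS.
congr (_ * integral _ _ _).
apply/seteqP; split => t /=; rewrite !in_itv /= /branch ltr_pM2r ?invr_gt0 // ler_pM2r ?invr_gt0 //;
  by rewrite -natr1; lra.
Qed.

(** The branch [j] maps the unit interval onto the [j]-th of the [N] equal
    pieces into which it is cut. *)
Lemma ge0_integral_branch_sum N (f : R -> \bar R) : (0 < N)%N ->
  measurable_fun [set: measurableTypeR R] f -> (forall t, 0 <= f t) ->
  \int[leb]_(t in `]0%R, 1%R]) f t =
  \sum_(j < N) (N%:R^-1)%:E * \int[leb]_(t in `]0%R, 1%R]) f (branch N j t).
Proof.
move=> N0 mf f0.
have N0R : (0 < N%:R :> R)%R by rewrite ltr0n.
(* the first k pieces, by induction on k *)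
suff H k : \int[leb]_(t in `]0%R, (k%:R / N%:R)%R]) f t =
    \sum_(j < k) (N%:R^-1)%:E * \int[leb]_(t in `]0%R, 1%R]) f (branch N j t).
  by rewrite -H divff // gt_eqF.
elim: k => [|k IH].
  by rewrite mul0r set_itvoc0 integral_set0 big_ord0.
rewrite big_ord_recr /= -IH -ge0_integral_branch //.
have k0 : (0 <= k%:R / N%:R :> R)%R by rewrite divr_ge0.
have kS : (k%:R / N%:R <= k.+1%:R / N%:R :> R)%R.
  by rewrite ler_pM2r ?invr_gt0 // ler_nat.
rewrite (@itv_bndbnd_setU _ _ (BRight 0%R) (BRight (k%:R / N%:R)%R)
  (BRight (k.+1%:R / N%:R)%R)) ?bnd_simp //.
rewrite ge0_integral_setU //; first exact: measurable_funTS.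
apply/disj_setPS => x [] /=; rewrite !in_itv /= => /andP[_ xk] /andP[kx _].
by move: (lt_le_trans kx xk); rewrite ltxx.
Qed.

Lemma ge0_integral_haar (F : circle R -> \bar R) :
  measurable_fun setT F -> (forall z, 0 <= F z) ->
  \int[mu]_z F z = \int[leb]_(t in `]0%R, 1%R]) F (expi t).
Proof.
move=> mF F0.
have me := @measurable_expi R.
have mFe : measurable_fun setT (F \o @expi R) by exact: measurableT_comp.
rewrite ge0_integral_pushforward //= integral_uniform //=.
rewrite subr0 invr1 mul1e -integral_itv_obnd_cbnd //.
exact: measurable_funTS.
Qed.

Lemma ge0_integral_haar_branch N (F : circle R -> \bar R) : (0 < N)%N ->
  measurable_fun setT F -> (forall z, 0 <= F z) ->
  \int[mu]_z F z = \int[leb]_(t in `]0%R, 1%R])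
    ((N%:R^-1)%:E * \sum_(j < N) F (expi (branch N j t))).
Proof.
move=> N0 mF F0.
have me := @measurable_expi R.
have mFe : measurable_fun setT (F \o @expi R) by exact: measurableT_comp.
have mFb j : measurable_fun setT (fun t : measurableTypeR R => F (expi (branch N j t))).
  exact: (measurableT_comp mFe (measurable_branch N j)).
have mFb' (D : set (measurableTypeR R)) (j : nat) : measurable_fun D
    (fun t : measurableTypeR R => F (expi (branch N j t))).
  exact: (measurable_funS measurableT _ (mFb j)).
rewrite ge0_integral_haar // (@ge0_integral_branch_sum N (F \o @expi R)) //;
  last by move=> t /=.
rewrite -ge0_sume_distrr; last by move=> j _; apply: integral_ge0 => t _; exact: F0.
rewrite [RHS]ge0_integralZl //; last 2 first.
- apply: (@emeasurable_sum _ _ _ _ _ _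
    (fun (j : 'I_N) (t : measurableTypeR R) => F (expi (branch N j t)))) => j.
  exact: mFb'.
- by move=> t _; exact: sume_ge0.
rewrite (@ge0_integral_sum _ _ _ _ _ _ _
    (fun (j : 'I_N) (t : measurableTypeR R) => F (expi (branch N j t)))) //.
Qed.

Lemma haar_lebesgue (A : set (circle R)) : measurable A ->
  mu A = leb (`]0%R, 1%R] `&` (@expi R) @^-1` A).
Proof.
move=> mA.
have meA : measurable ((@expi R) @^-1` A).
  by rewrite -[X in measurable X]setTI; exact: measurable_expi.
have := @ge0_integral_haar (fun z => (\1_A z)%:E) _ (fun z => _).
rewrite integral_indic // setIT => ->; last 2 first.
- by apply/measurable_EFinP; exact: measurable_indic.
- by move=> z; rewrite lee_fin.
rewrite (eq_integral (fun t => (\1_((@expi R) @^-1` A) t)%:E)) //.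
by rewrite integral_indic // setIC.
Qed.

Lemma ae_expi (P : circle R -> Prop) : {ae mu, forall z, P z} ->
  {ae leb, forall t, `]0%R, 1%R]%classic t -> P (expi t)}.
Proof.
move=> [A [mA A0 PA]]; exists (`]0%R, 1%R] `&` (@expi R) @^-1` A); split.
- apply: measurableI => //.
  by rewrite -[X in measurable X]setTI; exact: measurable_expi.
- by rewrite -haar_lebesgue.
- by move=> t /= /not_implyP[t01 nP]; split => //; exact: PA.
Qed.

(** The map [z |-> z ^+ N] preserves the Haar measure: the indicator of a
    preimage is constant on fibres. *)
Lemma ae_circleX N (P : circle R -> Prop) : (0 < N)%N -> {ae mu, forall z, P z} ->
  {ae mu, forall z, P (circleX N z)}.
Proof.
move=> N0 [A [mA A0 PA]]; exists ((@circleX R N) @^-1` A).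
have mB : measurable ((@circleX R N) @^-1` A).
  by rewrite -[X in measurable X]setTI; exact: measurable_circleX.
split=> //; last by move=> z /= nP; exact: PA.
have <- : \int[mu]_z (\1_((@circleX R N) @^-1` A) z)%:E = mu ((@circleX R N) @^-1` A).
  by rewrite integral_indic // setIT.
rewrite (@ge0_integral_haar_branch N) //; last first.
  by apply/measurable_EFinP; exact: measurable_indic.
rewrite (eq_integral (fun t => (\1_A (expi t))%:E)); last first.
  move=> t _; rewrite (eq_bigr (fun=> (\1_A (expi t))%:E)); last first.
    by move=> j _; rewrite -[in RHS](@circleX_branch _ N j).
  rewrite sumEFin sumr_const card_ord -EFinM -[X in (_ * X)%R]mulr_natl mulKf //.
  by rewrite pnatr_eq0 -lt0n.
rewrite -(@ge0_integral_haar (fun z => (\1_A z)%:E)) //.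
- by rewrite integral_indic // setIT.
- by apply/measurable_EFinP; exact: measurable_indic.
Qed.

Local Open Scope ring_scope.

Definition fibre_mean N (G : circle R -> R) (t : measurableTypeR R) : R :=
  N%:R^-1 * \sum_(j < N) G (expi (branch N j t)).

Lemma Rintegral_fibre_mean_ge0 N (G : circle R -> R) : (0 < N)%N ->
  mu.-integrable setT (EFin \o G) -> (forall z, 0 <= G z) ->
  leb.-integrable `]0, 1]%classic (EFin \o fibre_mean N G) /\
  \int[mu]_z G z = \int[leb]_(t in `]0, 1]) fibre_mean N G t.
Proof.
move=> N0 iG G0.
have mG := measurable_int _ iG.
have E : (\int[mu]_z (G z)%:E = \int[leb]_(t in `]0%R, 1%R]) (fibre_mean N G t)%:E)%E.
  rewrite (@ge0_integral_haar_branch N (EFin \o G)) //.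
  by apply: eq_integral => t _; rewrite sumEFin -EFinM.
have m0 t : 0 <= fibre_mean N G t.
  by rewrite /fibre_mean mulr_ge0 ?invr_ge0 // sumr_ge0.
split; last by rewrite /Rintegral E.
apply/integrableP; split.
  apply/measurable_EFinP; apply: measurable_funM => //.
  apply: measurable_sum => j.
  have mG' : measurable_fun setT G by apply/measurable_EFinP.
  apply: (measurable_funS measurableT) => //.
  exact: (measurableT_comp (measurableT_comp mG' (@measurable_expi R)) (measurable_branch N j)).
under eq_integral do rewrite gee0_abs ?lee_fin //.
rewrite -E; have /integrableP[_] := iG.
by under eq_integral do rewrite gee0_abs ?lee_fin //.
Qed.

Lemma Rintegral_fibre_mean N (G : circle R -> R) : (0 < N)%N ->
  mu.-integrable setT (EFin \o G) ->
  leb.-integrable `]0, 1]%classic (EFin \o fibre_mean N G) /\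
  \int[mu]_z G z = \int[leb]_(t in `]0, 1]) fibre_mean N G t.
Proof.
move=> N0 iG.
have [] := Rintegral_fibre_mean_ge0 N0 (integrable_funrpos measurableT iG).
  by move=> z; exact: funrpos_ge0.
have [] := Rintegral_fibre_mean_ge0 N0 (integrable_funrneg measurableT iG).
  by move=> z; exact: funrneg_ge0.
set Gp := funrpos G; set Gn := funrneg G.
move=> in1 in2 ip1 ip2.
have EG : G = (fun z => Gp z - Gn z) by rewrite -[LHS]funrposBneg.
have EM : fibre_mean N G = (fun t => fibre_mean N Gp t - fibre_mean N Gn t).
  by apply/funext => t; rewrite /fibre_mean -mulrBr -sumrB {1}EG.
split.
  rewrite EM; have := integrableB _ ip1 in1; apply => //.
rewrite EM [RHS]RintegralB // -in2 -ip2 -RintegralB //; last 2 first.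
- exact: integrable_funrpos.
- exact: integrable_funrneg.
by congr (Rintegral _ _ _).
Qed.

(** [K] only has to be known almost everywhere as the fibre mean of [G]: this
    is what the equation satisfied by a fixed point of the transfer operator
    gives. *)
Lemma Rintegral_fibre N (G K : circle R -> R) : (0 < N)%N ->
  mu.-integrable setT (EFin \o G) -> mu.-integrable setT (EFin \o K) ->
  {ae leb, forall t, `]0, 1]%classic t -> fibre_mean N G t = K (expi t)} ->
  \int[mu]_z G z = \int[mu]_z K z.
Proof.
move=> N0 iG iK GK.
have [iG' ->] := Rintegral_fibre_mean N0 iG.
(* with one branch, the fibre mean of K is K itself in angular coordinate *)
have [iK' ->] := Rintegral_fibre_mean (ltn0Sn 0) iK.
rewrite /Rintegral; congr fine; apply: ae_eq_integral => //.
- exact: (measurable_int _ iG').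
- exact: (measurable_int _ iK').
have [A [mA A0 GA]] := GK; exists A; split=> // t /= nt; apply: GA => /= h; apply: nt.
move=> t01; congr EFin; rewrite h //.
by rewrite /fibre_mean big_ord1 invr1 mul1r /branch addr0 divr1.
Qed.

End CircleIntegral.

(** * Bounded and integrable functions on the circle *)

Section FunctionSpaceTheory.
Variable R : realType.
Notation C := R[i].
Notation mu := (haar R).
Implicit Types (f g h k m : circle R -> C) (a : C).

Lemma cmeasurable_cst a : cmeasurable (fun=> a : C).
Proof. by split; exact: measurable_cst. Qed.

Lemma cmeasurableD f g :
  cmeasurable f -> cmeasurable g -> cmeasurable (fun z => f z + g z).
Proof.
move=> [f1 f2] [g1 g2]; split.
- by under eq_fun do rewrite ReD; exact: measurable_funD.
- by under eq_fun do rewrite ImD; exact: measurable_funD.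
Qed.

Lemma cmeasurableJ f : cmeasurable f -> cmeasurable (fun z => (f z)^*).
Proof.
move=> [f1 f2]; split; first by under eq_fun do rewrite ReJ.
by under eq_fun do rewrite ImJ; exact: measurableT_comp.
Qed.

Lemma isLooP f : isLoo f <->
  cmeasurable f /\ exists M : R, {ae mu, forall z, nrm (f z) <= M}.
Proof.
by split=> -[mf [M fM]]; split => //; exists M; apply: filterS fM => z;
  rewrite le_nrm.
Qed.

Lemma isLoo_cst a : isLoo (fun=> a : C).
Proof.
by apply/isLooP; split; [exact: cmeasurable_cst|exists (nrm a); apply: aeW].
Qed.

Lemma isLooM f g : isLoo f -> isLoo g -> isLoo (fun z => f z * g z).
Proof.
move=> /isLooP[mf [M fM]] /isLooP[mg [M' gM]]; apply/isLooP; split.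
  exact: cmeasurableM.
exists (M * M'); apply: filterS2 fM gM => z fM gM.
by rewrite nrmM ler_pM ?nrm_ge0.
Qed.

Lemma isLooD f g : isLoo f -> isLoo g -> isLoo (fun z => f z + g z).
Proof.
move=> /isLooP[mf [M fM]] /isLooP[mg [M' gM]]; apply/isLooP; split.
  exact: cmeasurableD.
exists (M + M'); apply: filterS2 fM gM => z fM gM.
by apply: (le_trans (ler_nrmD _ _)); rewrite lerD.
Qed.

Lemma isLooJ f : isLoo f -> isLoo (fun z => (f z)^*).
Proof.
move=> /isLooP[mf [M fM]]; apply/isLooP; split; first exact: cmeasurableJ.
by exists M; apply: filterS fM => z; rewrite nrmJ.
Qed.

Lemma isLooZ a f : isLoo f -> isLoo (fun z => a * f z).
Proof. by apply: isLooM; exact: isLoo_cst. Qed.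

Lemma isLoo_circleX N f : (0 < N)%N -> isLoo f -> isLoo (fun z => f (circleX N z)).
Proof.
move=> N0 /isLooP[[f1 f2] [M fM]]; apply/isLooP; split; last first.
  by exists M; exact: (ae_circleX N0 fM).
by split; [exact: (measurableT_comp f1 (@measurable_circleX R N))
         |exact: (measurableT_comp f2 (@measurable_circleX R N))].
Qed.

Lemma isL1_cmeasurable h : isL1 h -> cmeasurable h.
Proof.
by move=> [/measurable_int/measurable_EFinP h1 /measurable_int/measurable_EFinP h2].
Qed.

Lemma measurable_nrm f : cmeasurable f -> measurable_fun setT (fun z => nrm (f z)).
Proof.
move=> [f1 f2].
under eq_fun do rewrite /nrm normc_def /=.
apply: (@measurableT_comp _ _ _ _ _ _ (@Num.sqrt R)).
  by apply: continuous_measurable_fun; exact: sqrt_continuous.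
by apply: measurable_funD; apply: measurable_funX.
Qed.

Lemma isL1P h : isL1 h <->
  cmeasurable h /\ mu.-integrable setT (fun z => (nrm (h z))%:E).
Proof.
split=> [hL|[[h1 h2] ih]].
  have mh := isL1_cmeasurable hL; split => //; case: hL => i1 i2.
  apply: (le_integrable measurableT _ _ (integrableD measurableT
    (integrable_norm i1) (integrable_norm i2))).
    by apply/measurable_EFinP; exact: measurable_nrm.
  move=> z _ /=; rewrite lee_fin ger0_norm ?nrm_ge0 // ger0_norm ?addr_ge0 //.
  exact: nrm_le_ReIm.
split; apply: (le_integrable measurableT _ _ ih).
- exact/measurable_EFinP.
- by move=> z _; rewrite lee_fin (ger0_norm (nrm_ge0 _)) normRe_le_nrm.
- exact/measurable_EFinP.
- by move=> z _; rewrite lee_fin (ger0_norm (nrm_ge0 _)) normIm_le_nrm.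
Qed.

(** The bound of [f] holds almost everywhere only, so that integrals, rather
    than integrands, are compared. *)
Lemma isL1M f h : isLoo f -> isL1 h -> isL1 (fun z => f z * h z).
Proof.
move=> /isLooP[mf [M fM]] /isL1P[mh /integrableP[mnh ih]].
have mfh := cmeasurableM mf mh.
apply/isL1P; split => //.
have mnfh := measurable_nrm mfh.
apply/integrableP; split; first exact/measurable_EFinP.
have M0 : {ae mu, forall z, nrm (f z) <= `|M|}.
  by apply: filterS fM => z /le_trans; apply; exact: ler_norm.
apply: (@le_lt_trans _ _ (\int[mu]_z ((`|M|)%:E * `|(nrm (h z))%:E|))%E).
  apply: ae_ge0_le_integral => //.
  - by apply: measurableT_comp => //; exact/measurable_EFinP.
  - by apply: measurable_funeM; exact: measurableT_comp.
  apply: filterS M0 => z fz _; rewrite -EFinM lee_fin nrmM normrM.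
  by rewrite ler_wpM2r // ger0_norm ?nrm_ge0.
rewrite ge0_integralZl //; last exact: measurableT_comp.
by apply: lte_mul_pinfty.
Qed.

Lemma isL1D f g : isL1 f -> isL1 g -> isL1 (fun z => f z + g z).
Proof.
move=> [f1 f2] [g1 g2]; split.
- under eq_fun do rewrite ReD EFinD; exact: integrableD.
- under eq_fun do rewrite ImD EFinD; exact: integrableD.
Qed.

Lemma isL1Z a f : isL1 f -> isL1 (fun z => a * f z).
Proof. by apply: isL1M; exact: isLoo_cst. Qed.

Lemma cintegralD f g : isL1 f -> isL1 g ->
  cintegral (fun z => f z + g z) = cintegral f + cintegral g.
Proof.
move=> [f1 f2] [g1 g2]; apply: complex_eqP; rewrite ?ReD ?ImD /=.
- by under [LHS]eq_Rintegral do rewrite ReD; rewrite RintegralD.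
- by under [LHS]eq_Rintegral do rewrite ImD; rewrite RintegralD.
Qed.

Lemma cintegralZ a f : isL1 f ->
  cintegral (fun z => a * f z) = a * cintegral f.
Proof.
move=> [f1 f2]; apply: complex_eqP; rewrite ?ReM ?ImM /=.
- under [LHS]eq_Rintegral do rewrite ReM.
  by rewrite RintegralB ?RintegralZl //;
    [exact: (integrableZl measurableT _ f1)|exact: (integrableZl measurableT _ f2)].
- under [LHS]eq_Rintegral do rewrite ImM.
  by rewrite RintegralD ?RintegralZl //;
    [exact: (integrableZl measurableT _ f2)|exact: (integrableZl measurableT _ f1)].
Qed.

Lemma Rintegral_ae_ge0 (G : circle R -> R) : mu.-integrable setT (EFin \o G) ->
  {ae mu, forall z, 0 <= G z} -> 0 <= \int[mu]_z G z.
Proof.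
move=> iG G0.
have -> : \int[mu]_z G z = \int[mu]_z funrpos G z.
  rewrite /Rintegral; congr fine; apply: ae_eq_integral => //.
  - exact: (measurable_int _ iG).
  - exact: (measurable_int _ (integrable_funrpos measurableT iG)).
  - by apply: filterS G0 => z Gz _ /=; congr EFin; rewrite /funrpos; apply/esym/max_idPl.
by apply: Rintegral_ge0.
Qed.

(** The transfer operator is dual to composition with [z |-> z ^+ N]: on each
    fibre [k (circleX N w)] is constant, and the mean of the other factor is
    [ruelle N m m' h]. *)
Lemma cintegral_ruelle_fixed N m m' h k : (0 < N)%N -> isLoo m -> isLoo m' ->
  isLoo k -> isL1 h -> {ae mu, forall z, ruelle N m m' h z = h z} ->
  cintegral (fun z => k (circleX N z) * ((m z)^* * m' z * h z)) =
  cintegral (fun z => k z * h z).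
Proof.
move=> N0 Lm Lm' Lk Lh fixh.
have LG : isL1 (fun z => k (circleX N z) * ((m z)^* * m' z * h z)).
  apply: isL1M; first exact: isLoo_circleX.
  by apply: isL1M => //; apply: isLooM => //; exact: isLooJ.
have LK : isL1 (fun z => k z * h z) by exact: isL1M.
have fibre t : ruelle N m m' h (expi t) = h (expi t) ->
    N%:R^-1 * \sum_(j < N) (let w := expi (branch N j t) in
      k (circleX N w) * ((m w)^* * m' w * h w)) = k (expi t) * h (expi t).
  move=> <-; rewrite ruelle_expi // mulrCA; congr (_ * _).
  by rewrite mulr_sumr; apply: eq_bigr => j _ /=; rewrite circleX_branch.
have [A [mA A0 hA]] := ae_expi fixh.
have NC : N%:R^-1 = (N%:R^-1)%:C :> C by rewrite fmorphV rmorph_nat.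
apply: complex_eqP => /=.
- apply: (Rintegral_fibre N0 LG.1 LK.1); exists A; split=> // t /= nt.
  apply: hA => /= H; apply: nt => t01; rewrite -(fibre _ (H t01)) NC ReM /= mul0r subr0.
  by rewrite raddf_sum.
- apply: (Rintegral_fibre N0 LG.2 LK.2); exists A; split=> // t /= nt.
  apply: hA => /= H; apply: nt => t01; rewrite -(fibre _ (H t01)) NC ImM /= mul0r addr0.
  by rewrite raddf_sum.
Qed.

Lemma cintegral_sqr_ge0 f h : isLoo f -> isL1 h -> {ae mu, forall z, 0 <= h z} ->
  0 <= complex.Re (cintegral (fun z => (f z)^* * f z * h z)).
Proof.
move=> Lf Lh h0 /=.
have [] := isL1M (isLooM (isLooJ Lf) Lf) Lh => i1 _.
apply: Rintegral_ae_ge0 => //; apply: filterS h0 => z.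
rewrite lecE /= => /andP[/eqP hi hr].
rewrite !ReM !ImM ReJ ImJ hi mulr0 subr0 mulr_ge0 //; nra.
Qed.

(** Cauchy-Schwarz for two different densities [h], [h'] and a cross density
    [h0] dominated by their geometric mean. For real [s], integrating the
    pointwise inequality of arithmetic and geometric means gives a nonnegative
    quadratic polynomial in [s]; the inequality on its discriminant is the claim
    multiplied by the square of the modulus of the left-hand integral. *)
Lemma cintegral_cauchy_schwarz f g h h' h0 (c : R) : isLoo f -> isLoo g ->
  isL1 h -> isL1 h' -> isL1 h0 -> 0 <= c ->
  {ae mu, forall z, 0 <= h z} -> {ae mu, forall z, 0 <= h' z} ->
  {ae mu, forall z, `|h0 z| ^+ 2 <= c%:C * h z * h' z} ->
  nrm (cintegral (fun z => (f z)^* * g z * h0 z)) ^+ 2 <=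
  c * complex.Re (cintegral (fun z => (f z)^* * f z * h z))
    * complex.Re (cintegral (fun z => (g z)^* * g z * h' z)).
Proof.
move=> Lf Lg Lh Lh' Lh0 c0 hpos h'pos h0le.
set I := cintegral _; set A := complex.Re _; set B := complex.Re _.
have LI : isL1 (fun z => (f z)^* * g z * h0 z) by apply: isL1M => //; apply: isLooM => //; exact: isLooJ.
have LA : isL1 (fun z => (f z)^* * f z * h z) by apply: isL1M => //; apply: isLooM => //; exact: isLooJ.
have LB : isL1 (fun z => (g z)^* * g z * h' z) by apply: isL1M => //; apply: isLooM => //; exact: isLooJ.
have A0 : 0 <= A by exact: cintegral_sqr_ge0.
have B0 : 0 <= B by exact: cintegral_sqr_ge0.
have key : (- nrm I ^+ 2) ^+ 2 <= (nrm I ^+ 2 * c * A) * B.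
  apply: discriminant_le; first by rewrite !mulr_ge0 ?nrm_ge0.
  move=> s.
  (* the conjugate of I makes the cross term real after integration *)
  pose F z := (s ^+ 2 * (nrm I ^+ 2 * c))%:C * ((f z)^* * f z * h z) +
    ((- s *+ 2)%:C * I^*) * ((f z)^* * g z * h0 z) + (g z)^* * g z * h' z.
  have LF : isL1 F by apply: isL1D => //; apply: isL1D; exact: isL1Z.
  have EF : complex.Re (cintegral F) =
      s ^+ 2 * (nrm I ^+ 2 * c * A) + s * (- nrm I ^+ 2) *+ 2 + B.
    rewrite /F !cintegralD ?cintegralZ //; try exact: isL1Z; last first.
      by apply: isL1D; exact: isL1Z.
    rewrite -/I !ReD nrm_sqr /A /B.
    case: (cintegral _) => a1 a2; case: (cintegral _) => b1 b2.
    by case: (I) => i1 i2 /=; ring.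
  rewrite -EF /=; apply: Rintegral_ae_ge0; first exact: LF.1.
  apply: filterS3 hpos h'pos h0le => z hz h'z h0z.
  move: hz h'z; rewrite !lecE /= => /andP[/eqP hi hr] /andP[/eqP h'i h'r].
  have h0z' : nrm (h0 z) ^+ 2 <= c * complex.Re (h z) * complex.Re (h' z).
    move: h0z; rewrite nrmE -rmorphXn lecE /= => /andP[_].
    by rewrite !ReM !ImM /= hi h'i; lra.
  pose p := s ^+ 2 * (nrm I ^+ 2 * c) * (nrm (f z) ^+ 2 * complex.Re (h z)).
  pose q := nrm (g z) ^+ 2 * complex.Re (h' z).
  pose r := complex.Re (s%:C * (I^* * ((f z)^* * g z * h0 z))).
  have -> : complex.Re (F z) = p + q - r *+ 2.
    rewrite /F /p /q /r !ReD.
    rewrite !ReM !ImM /= !ReJ !ImJ hi h'i !nrm_sqr /=; ring.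
  have sI := mulr_ge0 (sqr_ge0 s) (mulr_ge0 (sqr_ge0 (nrm I)) c0).
  have p0 : 0 <= p := mulr_ge0 sI (mulr_ge0 (sqr_ge0 (nrm (f z))) hr).
  have q0 : 0 <= q := mulr_ge0 (sqr_ge0 (nrm (g z))) h'r.
  have rpq : r ^+ 2 <= p * q.
    apply: (@le_trans _ _ (nrm (s%:C * (I^* * ((f z)^* * g z * h0 z))) ^+ 2)).
      by rewrite nrm_sqr lerDl sqr_ge0.
    rewrite !nrmM !nrmJ nrm_real !exprMn real_normK ?num_real //.
    have -> : p * q = s ^+ 2 * (nrm I ^+ 2 * (nrm (f z) ^+ 2 * nrm (g z) ^+ 2 *
      (c * complex.Re (h z) * complex.Re (h' z)))) by rewrite /p /q; ring.
    apply: (ler_wpM2l (sqr_ge0 s)); apply: (ler_wpM2l (sqr_ge0 (nrm I))).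
    apply: ler_wpM2l => //.
    exact: (mulr_ge0 (sqr_ge0 (nrm (f z))) (sqr_ge0 (nrm (g z)))).
  rewrite leNgt; apply/negP => pqr; have := sqr_ge0 (p - q).
  have : (p + q) ^+ 2 < (r *+ 2) ^+ 2 by rewrite ltr_pXn2r ?nnegrE ?addr_ge0 //; lra.
  by lra.
have [->|I0] := eqVneq (nrm I) 0; first by rewrite expr0n !mulr_ge0.
have I2 : 0 < nrm I ^+ 2 by rewrite exprn_gt0 // lt_neqAle eq_sym I0 nrm_ge0.
rewrite -(ler_pM2l I2); move: key; rewrite sqrrN expr2; lra.
Qed.

End FunctionSpaceTheory.

(** * Generators of a cyclic representation *)

Section CyclicRepresentations.
Variables (R : realType) (N : nat) (m0 h : circle R -> R[i]).
Variables (H : hilbertType R) (rho : (circle R -> R[i]) -> H -> H).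
Variables (U : unitary H) (phi : H).
Hypothesis N0 : (0 < N)%N.
Hypothesis m0_Loo : isLoo m0.
Hypothesis cyc : cyclic_representation N m0 h rho U phi.
Local Notation V := (unitary_inv U).

(** The generic generator [U ^-n (rho f phi)]; [n] is called its level. *)
Definition cyclic_vector n f : H := iter n V (rho f phi).
Local Notation vec := cyclic_vector.

Lemma rho_unitary_inv f x : isLoo f -> rho f (V x) = V (rho (fun z => f (circleX N z)) x).
Proof.
by move=> Lf; apply: (can_inj (@unitaryK _ _ U)); rewrite unitaryVK (cyc_covariant cyc).
Qed.

Lemma cyclic_vector_linear n (a : R[i]) f g : isLoo f -> isLoo g ->
  vec n (fun z => a * f z + g z) = a *: vec n f + vec n g.
Proof.
move=> Lf Lg; rewrite /vec (rep_linear (cyc_rep cyc)) //.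
by elim: n => //= n ->; rewrite unitary_inv_linear.
Qed.

(** The scaling identity [U phi = rho m0 phi] makes the subspaces generated by
    the vectors of level [n] increase with [n]. *)
Lemma cyclic_vectorS n f : isLoo f ->
  vec n f = vec n.+1 (fun z => f (circleX N z) * m0 z).
Proof.
move=> Lf; rewrite /vec iterSr; congr (iter n _ _).
rewrite (rep_mul (cyc_rep cyc)) //; last exact: isLoo_circleX.
by rewrite -(cyc_refine cyc) -rho_unitary_inv // unitaryK.
Qed.

Lemma cyclic_vector_lift n k f : isLoo f -> (n <= k)%N ->
  exists2 f', isLoo f' & vec n f = vec k f'.
Proof.
move=> Lf /subnK <-; elim: (k - n)%N => [|d [f' Lf' ->]]; first by exists f.
exists (fun z => f' (circleX N z) * m0 z); last exact: cyclic_vectorS.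
by apply: isLooM => //; exact: isLoo_circleX.
Qed.

Definition cyclic_span : set H :=
  [set x | exists n f, isLoo f /\ x = iter n V (rho f phi)].

Lemma cyclic_vector_span n f : isLoo f -> cyclic_span (vec n f).
Proof. by move=> Lf; exists n, f. Qed.

(** Linear combinations and pairings are computed after raising all vectors to
    one level; the bound [n0] is there to combine the thresholds of two
    vectors. *)
Lemma cyclic_span_lift x n0 : cyclic_span x ->
  exists2 n, (n0 <= n)%N & forall k, (n <= k)%N -> exists2 f, isLoo f & x = vec k f.
Proof.
move=> [n [f [Lf ->]]]; exists (maxn n0 n); first exact: leq_maxl.
move=> k; rewrite geq_max => /andP[_ nk].
exact: cyclic_vector_lift.
Qed.

Lemma cyclic_span_subspace : subspace cyclic_span.
Proof.
split; first by exists (vec 0 (fun=> 1)); exact/cyclic_vector_span/isLoo_cst.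
move=> a x y /(cyclic_span_lift 0)[n _ hx] /(cyclic_span_lift n)[k nk hy].
have [f Lf ->] := hx k nk; have [g Lg ->] := hy k (leqnn k).
rewrite -cyclic_vector_linear //; apply: cyclic_vector_span.
by apply: isLooD => //; exact: isLooZ.
Qed.

Lemma rho_star f x y : isLoo f -> inner (rho f x) y = inner x (rho (fun z => (f z)^*) y).
Proof. by move=> Lf; rewrite (rep_star (cyc_rep cyc)). Qed.

Lemma rho_starr f x y : isLoo f -> inner x (rho f y) = inner (rho (fun z => (f z)^*) x) y.
Proof.
move=> Lf; rewrite rho_star; last exact: isLooJ.
by congr (inner x (rho _ y)); apply/funext => z; rewrite conjCK.
Qed.

(** Every level carries the same norm, that of the functions which are square
    integrable against [h], because [U] is unitary. *)
Lemma nrm_cyclic_vector n f : isLoo f ->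
  nrm (vec n f) ^+ 2 = complex.Re (cintegral (fun z => (f z)^* * f z * h z)).
Proof.
move=> Lf; have := inner_nrm (vec n f).
rewrite iter_unitary_inv_inner rho_star // -(rep_mul (cyc_rep cyc)) //; last exact: isLooJ.
rewrite (cyc_state cyc); last by apply: isLooM => //; exact: isLooJ.
by move=> ->.
Qed.

(** Moving [rho k] through [U ^-1] composes [k] with [z |-> z ^+ N]. *)
Lemma rho_cyclic_vector k n f : isLoo k -> isLoo f ->
  rho k (vec n f) = vec n (fun z => k (iter n (@circleX R N) z) * f z).
Proof.
rewrite /vec; elim: n k => [|n IH] k Lk Lf /=.
  by rewrite -(rep_mul (cyc_rep cyc)).
rewrite rho_unitary_inv // IH //; exact: isLoo_circleX.
Qed.

End CyclicRepresentations.

(** * The intertwining operator *)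

Section Intertwiners.
Variables (R : realType) (N : nat) (m0 m0' h h' : circle R -> R[i]).
Variables (H : hilbertType R) (rho : (circle R -> R[i]) -> H -> H).
Variables (U : unitary H) (phi : H).
Variables (H' : hilbertType R) (rho' : (circle R -> R[i]) -> H' -> H').
Variables (U' : unitary H') (phi' : H').
Hypothesis N0 : (0 < N)%N.
Hypothesis m0_Loo : isLoo m0.
Hypothesis m0'_Loo : isLoo m0'.
Hypothesis cyc : cyclic_representation N m0 h rho U phi.
Hypothesis cyc' : cyclic_representation N m0' h' rho' U' phi'.
Variables (h0 : circle R -> R[i]) (c : R).
Hypothesis h_L1 : isL1 h.
Hypothesis h'_L1 : isL1 h'.
Hypothesis h0_L1 : isL1 h0.
Hypothesis h_ge0 : {ae haar R, forall z, 0 <= h z}.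
Hypothesis h'_ge0 : {ae haar R, forall z, 0 <= h' z}.
Hypothesis h0_fix : {ae haar R, forall z, ruelle N m0 m0' h0 z = h0 z}.
Hypothesis c_gt0 : 0 < c.
Hypothesis h0_le : {ae haar R, forall z, `|h0 z| ^+ 2 <= c%:C * h z * h' z}.

Local Notation vec := (cyclic_vector rho U phi).
Local Notation vec' := (cyclic_vector rho' U' phi').
Local Notation D := (cyclic_span rho U phi).
Local Notation D' := (cyclic_span rho' U' phi').

(** The value forced on [inner (vec n f) (S (vec' n g))] for every level [n]. *)
Definition pairing f g : R[i] := cintegral (fun z => (f z)^* * g z * h0 z).

Lemma pairing_linear a f g1 g2 : isLoo f -> isLoo g1 -> isLoo g2 ->
  pairing f (fun z => a * g1 z + g2 z) = a * pairing f g1 + pairing f g2.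
Proof.
move=> Lf L1 L2; rewrite /pairing.
have L g : isLoo g -> isL1 (fun z => (f z)^* * g z * h0 z).
  by move=> Lg; apply: isL1M => //; apply: isLooM => //; exact: isLooJ.
rewrite -cintegralZ; last exact: L.
rewrite -(cintegralD (isL1Z a (L _ L1)) (L _ L2)).
by congr cintegral; apply/funext => z; ring.
Qed.

Lemma pairing_antilinear a f1 f2 g : isLoo f1 -> isLoo f2 -> isLoo g ->
  pairing (fun z => a * f1 z + f2 z) g = a^* * pairing f1 g + pairing f2 g.
Proof.
move=> L1 L2 Lg; rewrite /pairing.
have L f : isLoo f -> isL1 (fun z => (f z)^* * g z * h0 z).
  by move=> Lf; apply: isL1M => //; apply: isLooM => //; exact: isLooJ.
rewrite -cintegralZ; last exact: L.
rewrite -(cintegralD (isL1Z a^* (L _ L1)) (L _ L2)).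
by congr cintegral; apply/funext => z; rewrite rmorphD rmorphM /=; ring.
Qed.

Lemma pairing_bound n k f g : isLoo f -> isLoo g ->
  nrm (pairing f g) <= Num.sqrt c * nrm (vec n f) * nrm (vec' k g).
Proof.
move=> Lf Lg; rewrite -(ler_pXn2r (n := 2)) ?nnegrE ?nrm_ge0 //; last first.
  by rewrite !mulr_ge0 ?nrm_ge0 ?sqrtr_ge0.
rewrite !exprMn (sqr_sqrtr (ltW c_gt0)) (nrm_cyclic_vector cyc) // (nrm_cyclic_vector cyc') //.
by apply: cintegral_cauchy_schwarz => //; exact: ltW.
Qed.

(** This is where [h0] being fixed by the transfer operator is used: the pairing
    does not change when both vectors are rewritten one level higher. *)
Lemma pairing_lift f g : isLoo f -> isLoo g ->
  pairing (fun z => f (circleX N z) * m0 z) (fun z => g (circleX N z) * m0' z) =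
  pairing f g.
Proof.
move=> Lf Lg.
rewrite /pairing -(@cintegral_ruelle_fixed R N m0 m0' h0 (fun z => (f z)^* * g z)) //.
- by congr cintegral; apply/funext => z; rewrite rmorphM /=; ring.
- by apply: isLooM => //; exact: isLooJ.
Qed.

Lemma pairing_lift_to n k f g : isLoo f -> isLoo g -> (n <= k)%N ->
  exists f' g', [/\ isLoo f', isLoo g', vec n f = vec k f', vec' n g = vec' k g' &
    pairing f' g' = pairing f g].
Proof.
move=> Lf Lg /subnK <-; elim: (k - n)%N => [|d [f' [g' [Lf' Lg' -> -> <-]]]].
  by exists f, g.
exists (fun z => f' (circleX N z) * m0 z), (fun z => g' (circleX N z) * m0' z); split.
- by apply: isLooM => //; exact: isLoo_circleX.
- by apply: isLooM => //; exact: isLoo_circleX.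
- exact: (cyclic_vectorS N0 m0_Loo cyc).
- exact: (cyclic_vectorS N0 m0'_Loo cyc').
- exact: pairing_lift.
Qed.

(** By [pairing_bound], a function representing the zero vector pairs to zero. *)
Lemma pairing_level k f1 f2 g1 g2 :
  isLoo f1 -> isLoo f2 -> isLoo g1 -> isLoo g2 ->
  vec k f1 = vec k f2 -> vec' k g1 = vec' k g2 -> pairing f1 g1 = pairing f2 g2.
Proof.
move=> Lf1 Lf2 Lg1 Lg2 ef eg.
have L0 (f1' f2' : circle R -> R[i]) : isLoo f1' -> isLoo f2' -> isLoo (fun z => -1 * f1' z + f2' z).
  by move=> L1 L2; apply: isLooD => //; exact: isLooZ.
have nrm00 (W : hilbertType R) (v : W) : nrm (-1 *: v + v) = 0.
  by rewrite scaleN1r addNr /nrm normr0.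
transitivity (pairing f1 g2); apply/esym/eqP; rewrite -subr_eq0 addrC; apply/eqP/nrm0_eq0.
- apply/eqP; rewrite eq_le nrm_ge0 andbT.
  have := @pairing_bound k k f1 _ Lf1 (L0 _ _ Lg1 Lg2).
  rewrite pairing_linear // (cyclic_vector_linear cyc') // eg nrm00 mulr0.
  by rewrite mulN1r.
- apply/eqP; rewrite eq_le nrm_ge0 andbT.
  have := @pairing_bound k k _ g2 (L0 _ _ Lf1 Lf2) Lg2.
  rewrite pairing_antilinear // (cyclic_vector_linear cyc) // ef nrm00 mulr0 mul0r.
  by rewrite rmorphN1 mulN1r addrC -opprB nrmN addrC.
Qed.

(** The sesquilinear form on the two spans given by [pairing], through any common
    level at which the two vectors can be written; [cyclic_formE] says that the
    choice of the level and of the functions is immaterial. *)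
Definition cyclic_form (x : H) (y : H') : R[i] :=
  xget 0 [set b | exists n f g, [/\ isLoo f, isLoo g, x = vec n f, y = vec' n g &
    b = pairing f g]].

Lemma cyclic_formE n f g : isLoo f -> isLoo g ->
  cyclic_form (vec n f) (vec' n g) = pairing f g.
Proof.
move=> Lf Lg; rewrite /cyclic_form; apply: xget_unique.
  by exists n, f, g.
move=> _ [k [f' [g' [Lf' Lg' ef eg ->]]]].
have [F [G [LF LG eF eG <-]]] := pairing_lift_to Lf Lg (leq_maxl n k).
have [F' [G' [LF' LG' eF' eG' <-]]] := pairing_lift_to Lf' Lg' (leq_maxr n k).
by apply: (pairing_level (k := maxn n k)) => //; rewrite -?eF -?eF' -?eG -?eG'.
Qed.

Lemma common_level x y : D x -> D' y -> exists n, forall k, (n <= k)%N ->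
  exists f g, [/\ isLoo f, isLoo g, x = vec k f & y = vec' k g].
Proof.
move=> /(cyclic_span_lift N0 m0_Loo cyc 0)[n _ hx].
move=> /(cyclic_span_lift N0 m0'_Loo cyc' n)[k nk hy].
exists k => j kj; have [f Lf ->] := hx j (leq_trans nk kj).
by have [g Lg ->] := hy j kj; exists f, g.
Qed.

Lemma cyclic_form_operator : exists S : H' -> H,
  [/\ linear S, forall y, nrm (S y) <= Num.sqrt c * nrm y &
    forall x y, D x -> D' y -> inner x (S y) = cyclic_form x y].
Proof.
apply: bounded_form_operator; first exact: sqrtr_ge0.
- exact: (cyclic_span_subspace N0 m0_Loo cyc).
- exact: (cyclic_span_subspace N0 m0'_Loo cyc').
- exact: (cyc_dense cyc).
- exact: (cyc_dense cyc').
- move=> y Dy a x1 x2 Dx1 Dx2.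
  have [n1 h1] := common_level Dx1 Dy.
  have [n2 h2] := common_level Dx2 Dy.
  have [f1 [g [Lf1 Lg -> ->]]] := h1 _ (leq_maxl n1 n2).
  have [f2 [_ [Lf2 _ -> _]]] := h2 _ (leq_maxr n1 n2).
  rewrite -(cyclic_vector_linear cyc) // !cyclic_formE //; last first.
    by apply: isLooD => //; exact: isLooZ.
  by rewrite pairing_antilinear // rmorphD rmorphM /= conjCK.
- move=> x Dx a y1 y2 Dy1 Dy2.
  have [n1 h1] := common_level Dx Dy1.
  have [n2 h2] := common_level Dx Dy2.
  have [f [g1 [Lf Lg1 -> ->]]] := h1 _ (leq_maxl n1 n2).
  have [_ [g2 [_ Lg2 _ ->]]] := h2 _ (leq_maxr n1 n2).
  rewrite -(cyclic_vector_linear cyc') // !cyclic_formE ?pairing_linear //.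
  by apply: isLooD => //; exact: isLooZ.
- move=> x y Dx Dy; have [n hn] := common_level Dx Dy.
  have [f [g [Lf Lg -> ->]]] := hn _ (leqnn n).
  by rewrite cyclic_formE //; exact: pairing_bound.
Qed.

Definition is_intertwiner (S : H' -> H) :=
  [/\ bounded_linear S,
      (forall x, S (U' x) = U (S x)),
      (forall f, isLoo f -> forall x, S (rho' f x) = rho f (S x)) &
      (forall f, isLoo f ->
         inner phi (rho f (S phi')) = cintegral (fun z => f z * h0 z))].

(** The intertwining relations move [S] past the powers of [U'] and past
    [rho' g], which reduces the inner product to the prescribed moments. *)
Lemma intertwiner_cyclic_form S : is_intertwiner S ->
  forall x y, D x -> D' y -> inner x (S y) = cyclic_form x y.
Proof.
move=> [_ SU Srho Sphi] x y Dx Dy; have [n hn] := common_level Dx Dy.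
have [f [g [Lf Lg -> ->]]] := hn _ (leqnn n).
rewrite cyclic_formE //.
have SV w : S (unitary_inv U' w) = unitary_inv U (S w).
  by apply: (can_inj (@unitaryK _ _ U)); rewrite unitaryVK -SU unitaryVK.
have -> : S (vec' n g) = iter n (unitary_inv U) (S (rho' g phi')).
  by rewrite /cyclic_vector; elim: n {hn} => //= n <-; rewrite SV.
rewrite iter_unitary_inv_inner Srho // (rho_star cyc) //.
rewrite -(rep_mul (cyc_rep cyc)) //; last exact: isLooJ.
by rewrite Sphi //; apply: isLooM => //; exact: isLooJ.
Qed.

(** Both operators have the matrix coefficients [cyclic_form] on dense
    subspaces. *)
Lemma intertwiner_unique S T : is_intertwiner S -> is_intertwiner T -> S = T.
Proof.
move=> iS iT; apply/funext.
have [bS _ _ _] := iS; have [bT _ _ _] := iT.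
apply: (bounded_linear_dense_eq bS bT (cyc_dense cyc')) => y Dy.
apply: (dense_inner_eq (cyc_dense cyc)) => x Dx.
by rewrite !intertwiner_cyclic_form.
Qed.

(** By density each relation is an identity between values of [cyclic_form], that
    is, between integrals: shifting the level of both vectors does not change
    the pairing, and a factor [k] may be moved from [g] to [f] as its
    conjugate. *)
Lemma exists_intertwiner : exists S : H' -> H, is_intertwiner S /\
  linear S /\ forall y, nrm (S y) <= Num.sqrt c * nrm y.
Proof.
have [S [lS SM SB]] := cyclic_form_operator.
exists S; split=> //.
have bS : bounded_linear S by apply/bounded_linearP; split => //; exists (Num.sqrt c).
split => //.
- apply: (bounded_linear_dense_eq
    (bounded_linear_comp bS (bounded_linear_unitary U'))
    (bounded_linear_comp (bounded_linear_unitary U) bS) (cyc_dense cyc')) => y Dy.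
  apply: (dense_inner_eq (cyc_dense cyc)) => x Dx.
  have [n hn] := common_level Dx Dy.
  have [f [_ [Lf _ -> _]]] := hn _ (leqnn n).
  (* y is written one level higher than x, so that U' lowers it to level n *)
  have [_ [g [_ Lg _ ->]]] := hn _ (leqnSn n).
  have -> : U' (vec' n.+1 g) = vec' n g by rewrite /cyclic_vector /= unitaryVK.
  rewrite unitary_adjoint SB ?cyclic_formE //; try exact: cyclic_vector_span.
  rewrite -[unitary_inv U (vec n f)]/(vec n.+1 f).
  rewrite SB ?cyclic_formE //; exact: cyclic_vector_span.
- move=> k Lk.
  apply: (bounded_linear_dense_eq
    (bounded_linear_comp bS (rep_bounded (cyc_rep cyc') Lk))
    (bounded_linear_comp (rep_bounded (cyc_rep cyc) Lk) bS) (cyc_dense cyc')) => y Dy.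
  apply: (dense_inner_eq (cyc_dense cyc)) => x Dx.
  have [n hn] := common_level Dx Dy.
  have [f [g [Lf Lg -> ->]]] := hn _ (leqnn n).
  have LkX n1 k1 : isLoo k1 -> isLoo (fun z => k1 (iter n1 (@circleX R N) z)).
    elim: n1 k1 => // n1 IH k1 Lk1 /=.
    by apply: (IH (fun z => k1 (circleX N z))); exact: isLoo_circleX.
  have LkJ := isLooJ Lk.
  rewrite (rho_starr cyc) // (rho_cyclic_vector N0 cyc) // (rho_cyclic_vector N0 cyc') //.
  have L1 : isLoo (fun z => k (iter n (@circleX R N) z) * g z) by apply: isLooM => //; exact: LkX.
  have L2 : isLoo (fun z => (k (iter n (@circleX R N) z))^* * f z).
    by apply: isLooM => //; exact: (LkX _ _ LkJ).
  rewrite !SB ?cyclic_formE //; try exact: cyclic_vector_span.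
  rewrite /pairing; congr cintegral; apply/funext => z.
  by rewrite rmorphM /= conjCK; ring.
- move=> f Lf.
  have L1 := @isLoo_cst R 1.
  have LJ := isLooJ Lf.
  rewrite (rho_starr cyc) // -[phi'](rep_one (cyc_rep cyc')).
  rewrite (SB (vec 0 _) (vec' 0 _)); try exact: cyclic_vector_span.
  rewrite cyclic_formE // /pairing; congr cintegral; apply/funext => z.
  by rewrite conjCK mulr1.
Qed.

End Intertwiners.

Theorem theorem2p4 (R : realType) (N : nat) (hN : (2 <= N)%N)
    (m0 m0' h h' : circle R -> R[i])
    (m0_Loo : isLoo m0) (m0'_Loo : isLoo m0')
    (m0_ns : nonsingular m0) (m0'_ns : nonsingular m0')
    (h_L1 : isL1 h) (h'_L1 : isL1 h')
    (h_ge0 : {ae haar R, forall z, 0 <= h z})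
    (h'_ge0 : {ae haar R, forall z, 0 <= h' z})
    (h_fix : {ae haar R, forall z, ruelle N m0 m0 h z = h z})
    (h'_fix : {ae haar R, forall z, ruelle N m0' m0' h' z = h' z})
    (H : hilbertType R) (rho : (circle R -> R[i]) -> H -> H)
    (U : unitary H) (phi : H)
    (H' : hilbertType R) (rho' : (circle R -> R[i]) -> H' -> H')
    (U' : unitary H') (phi' : H')
    (cyc : cyclic_representation N m0 h rho U phi)
    (cyc' : cyclic_representation N m0' h' rho' U' phi')
    (h0 : circle R -> R[i]) (h0_L1 : isL1 h0)
    (h0_fix : {ae haar R, forall z, ruelle N m0 m0' h0 z = h0 z})
    (c : R) (c_gt0 : 0 < c)
    (h0_le : {ae haar R, forall z, `|h0 z| ^+ 2 <= c%:C * h z * h' z}) :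
  let intertwiner (S : H' -> H) :=
    [/\ bounded_linear S,
        (forall x, S (U' x) = U (S x)),
        (forall f, isLoo f -> forall x, S (rho' f x) = rho f (S x)) &
        (forall f, isLoo f ->
           inner phi (rho f (S phi')) = cintegral (fun z => f z * h0 z))] in
  (exists! S : H' -> H, intertwiner S) /\
  (forall S : H' -> H, intertwiner S -> opnorm S <= Num.sqrt c).
Proof.
move=> intertwiner.
have N0 : (0 < N)%N by exact: leq_trans hN.
have [S [iS [lS SM]]] := exists_intertwiner N0 m0_Loo m0'_Loo cyc cyc'
  h_L1 h'_L1 h0_L1 h_ge0 h'_ge0 h0_fix c_gt0 h0_le.
have uniq T : intertwiner T -> S = T.
  by apply: (intertwiner_unique N0 m0_Loo m0'_Loo cyc cyc' h_L1 h'_L1 h0_L1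
    h_ge0 h'_ge0 h0_fix c_gt0 h0_le).
split; first by exists S.
by move=> T /uniq <-; apply: opnorm_le => //; exact: sqrtr_ge0.
Qed.
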